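(* Let $k$ be an algebraically closed field of characteristic $0$. If an iterated Hopf Ore extension $H$ of $k$ satisfies a polynomial identity, then $H$ is commutative.
   Context: An iterated Hopf Ore extension of $k$ (IHOE) is a Hopf $k$-algebra (with bijective antipode) $H=k[x_1][x_2;\sigma_2,\delta_2]\cdots[x_n;\sigma_n,\delta_n]$, an iterated skew polynomial algebra ($x_ir-\sigma_i(r)x_i=\delta_i(r)$ for $r\in H_{(i-1)}$), such that each $H_{(i)}:=k\langle x_1,\dots,x_i\rangle$ is a Hopf subalgebra of $H$, $\sigma_i$ is an algebra automorphism of $H_{(i-1)}$ and $\delta_i$ is a $\sigma_i$-derivation of $H_{(i-1)}$. *)

(* Defs.v *)
From Stdlib Require List.
From HB Require Import structures.
From mathcomp Require Import all_boot all_order all_algebra.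
Set Implicit Arguments. Unset Strict Implicit. Unset Printing Implicit Defensive.
Import Order.TTheory GRing.Theory Num.Theory.
Local Open Scope ring_scope.

Section Defs.
Variables (k : fieldType) (H : algType k).

(* n-fold tensor powers H^{(x) n} over k.  An element is represented by a
   formal sum  [:: t_1; ...; t_r]  of pure tensors, t_j : 'I_n -> H standing
   for t_j 0 (x) ... (x) t_j (n-1).  Equality in the tensor product is the
   congruence generated by the defining (multilinearity) relations;
   scalars and signs are absorbed into the factors.                      *)
Definition upd n (t : 'I_n -> H) (i : 'I_n) (a : H) : 'I_n -> H :=
  fun j => if j == i then a else t j.

Inductive tens_base n : seq ('I_n -> H) -> seq ('I_n -> H) -> Prop :=
  | tb_zero (t : 'I_n -> H) (i : 'I_n) : t i = 0 -> tens_base [:: t] [::]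
  | tb_add (t : 'I_n -> H) (i : 'I_n) (a b : H) : t i = a + b ->
      tens_base [:: t] [:: upd t i a; upd t i b]
  | tb_scale (t : 'I_n -> H) (i j : 'I_n) (c : k) :
      tens_base [:: upd t i (c *: t i)] [:: upd t j (c *: t j)]
  | tb_comm (s1 s2 : seq ('I_n -> H)) : tens_base (s1 ++ s2) (s2 ++ s1).

Definition tens_step n (s t : seq ('I_n -> H)) : Prop :=
  exists l r u v, [/\ s = l ++ u ++ r, t = l ++ v ++ r & tens_base u v].

Inductive teq n : seq ('I_n -> H) -> seq ('I_n -> H) -> Prop :=
  | teq_refl s : teq s s
  | teq_step s t : tens_step s t -> teq s t
  | teq_sym s t : teq s t -> teq t s
  | teq_trans s t u : teq s t -> teq t u -> teq s u.

Definition i20 : 'I_2 := ord0.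
Definition i21 : 'I_2 := ord_max.
Definition pure2 (a b : H) : 'I_2 -> H := fun i => if val i == 0%N then a else b.
Definition pure3 (a b c : H) : 'I_3 -> H :=
  fun i => if val i == 0%N then a else if val i == 1%N then b else c.

Definition tmul2 (s t : seq ('I_2 -> H)) : seq ('I_2 -> H) :=
  [seq (fun i => u i * v i) | u <- s, v <- t].

Definition is_hopf (Delta : H -> seq ('I_2 -> H)) (eps : H -> k) (S : H -> H) : Prop :=
  [/\
      (forall a b, teq (Delta (a + b)) (Delta a ++ Delta b)),
      (forall (c : k) a, teq (Delta (c *: a)) [seq upd u i20 (c *: u i20) | u <- Delta a]),
      (forall a b, teq (Delta (a * b)) (tmul2 (Delta a) (Delta b))),
      teq (Delta 1) [:: pure2 1 1] &
   [/\
      (forall h, teq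
         (flatten [seq [seq pure3 (v i20) (v i21) (u i21) | v <- Delta (u i20)] | u <- Delta h])
         (flatten [seq [seq pure3 (u i20) (v i20) (v i21) | v <- Delta (u i21)] | u <- Delta h])),
      [/\ (forall a b, eps (a + b) = eps a + eps b),
          (forall (c : k) a, eps (c *: a) = c * eps a),
          (forall a b, eps (a * b) = eps a * eps b) & eps 1 = 1],
      (forall h, \sum_(u <- Delta h) eps (u i20) *: u i21 = h /\
                 \sum_(u <- Delta h) eps (u i21) *: u i20 = h),
      (forall a b, S (a + b) = S a + S b) /\ (forall (c : k) a, S (c *: a) = c *: S a) &
      (forall h, \sum_(u <- Delta h) S (u i20) * u i21 = eps h *: 1 /\
                 \sum_(u <- Delta h) u i20 * S (u i21) = eps h *: 1)]].

Definition is_hopf_subalg (Delta : H -> seq ('I_2 -> H)) (S : H -> H) (K : H -> Prop) : Prop :=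
  [/\ K 1, (forall a b, K a -> K b -> K (a + b)),
      (forall (c : k) a, K a -> K (c *: a)),
      (forall a b, K a -> K b -> K (a * b)) &
   [/\ (forall a, K a -> K (S a)) &
       (forall a, K a -> exists s, teq (Delta a) s /\
           (forall u, List.In u s -> K (u i20) /\ K (u i21)))]].

Definition gen_subalg n (x : 'I_n -> H) (i : nat) (h : H) : Prop :=
  exists s : seq (k * seq 'I_n),
    (forall p, List.In p s -> forall j, List.In j p.2 -> (j < i)%N) /\
    h = \sum_(p <- s) p.1 *: \prod_(j <- p.2) x j.

Definition is_alg_aut_on (A : H -> Prop) (sigma : H -> H) : Prop :=
  [/\ (forall a, A a -> A (sigma a)),
      (forall a b, A a -> A b -> sigma (a + b) = sigma a + sigma b),
      (forall (c : k) a, A a -> sigma (c *: a) = c *: sigma a),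
      (forall a b, A a -> A b -> sigma (a * b) = sigma a * sigma b) &
   [/\ sigma 1 = 1,
       (forall a b, A a -> A b -> sigma a = sigma b -> a = b) &
       (forall b, A b -> exists2 a, A a & sigma a = b)]].

Definition is_sigma_der_on (A : H -> Prop) (sigma delta : H -> H) : Prop :=
  [/\ (forall a, A a -> A (delta a)),
      (forall a b, A a -> A b -> delta (a + b) = delta a + delta b),
      (forall (c : k) a, A a -> delta (c *: a) = c *: delta a) &
      (forall a b, A a -> A b -> delta (a * b) = sigma a * delta b + delta a * b)].

(* (H, Delta, eps, S) is an iterated Hopf Ore extension of k:
   H = k[x_1][x_2; s_2, d_2] ... [x_n; s_n, d_n] with every H_(i) a Hopf
   subalgebra and S bijective.  Generators are 0-indexed: x j, j : 'I_n, and
   H_(i) = gen_subalg x i. *)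
Definition is_IHOE (Delta : H -> seq ('I_2 -> H)) (eps : H -> k) (S : H -> H) : Prop :=
  is_hopf Delta eps S /\ bijective S /\
  exists n (x : 'I_n -> H) (sigma delta : 'I_n -> H -> H),
    [/\
        (forall h, gen_subalg x n h),
        (forall i, (i <= n)%N -> is_hopf_subalg Delta S (gen_subalg x i)) &
        (forall j : 'I_n,
          [/\ is_alg_aut_on (gen_subalg x j) (sigma j),
              is_sigma_der_on (gen_subalg x j) (sigma j) (delta j),
              (forall r, gen_subalg x j r -> x j * r - sigma j r * x j = delta j r) &
              (forall (m : nat) (r : 'I_m -> H), (forall l, gen_subalg x j (r l)) ->
                 \sum_(l < m) r l * x j ^+ l = 0 -> forall l, r l = 0)])].

(* H satisfies a polynomial identity: there is a nonzero noncommutative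
   polynomial f in k<X_0,...,X_(m-1)> (written in the basis of words, with
   distinct words) vanishing on all m-tuples of elements of H. *)
Definition eval_word m (h : 'I_m -> H) (w : seq 'I_m) : H := \prod_(j <- w) h j.

Definition PI_algebra : Prop :=
  exists m (f : seq (k * seq 'I_m)),
    [/\ uniq (map snd f), has (fun p => p.1 != 0) f &
        forall h : 'I_m -> H, \sum_(p <- f) p.1 *: eval_word h p.2 = 0].

End Defs.

(* Main.v *)
(** Let [A = R[x; sigma, delta]] be a step of the chain, with [R] commutative by
induction; it suffices that [sigma = 1] and [delta = 0].

If a PI algebra [A] acts on [R] so that every finite set of vectors is killed by
a nonzero operator, then the action is not faithful: otherwise one could build
operators and vectors isolating one monomial of a multilinear identity. Applied
to [A / A x] when [sigma = 1] this gives [delta = 0] in characteristic [0]; when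
[sigma <> 1], a change of variable [y] with [y r = sigma r y] and the module
[A / A (y - 1)] show that [sigma] has finite order [q].

If [sigma b <> b], each character [g] of [R] with [g (sigma b - b) <> 0] extends
to [A], and the corresponding winding endomorphism [tau] of [A] is injective and
preserves [R]. Comparing leading coefficients in [x r = sigma r x + delta r]
gives [sigma ^ d tau = tau sigma] on [R], where [d > 0] is the degree of [tau x];
[d] only matters modulo [q], so by density of such [g] the map [sigma] is itself
a winding automorphism [r |-> r_1 chi (r_2)], i.e. a translation of the group of
characters. A translation with a fixed point is trivial. Climbing the chain, if
[sigma] fixes [R_i], then on [R_{i+1} = R_i[x_i]] either it fixes a character
([k] is algebraically closed), or [sigma x_i = x_i + c], and then [q c = 0]. *)
Require Import Defs.
From Stdlib Require Import Classical ClassicalEpsilon.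
From HB Require Import structures.
From mathcomp Require Import all_boot all_order all_algebra.
Set Implicit Arguments. Unset Strict Implicit. Unset Printing Implicit Defensive.
Import GRing.Theory.
Local Open Scope ring_scope.

(** * From a polynomial identity to a multilinear one *)

Section Multilinear.
Variables (k : fieldType) (H : algType k).

(** The Möbius weight of inclusion-exclusion: the parity of the complement of [T], a subset being
    encoded by its indicator function. *)
Definition subset_sign d (T : {ffun 'I_d -> bool}) : k :=
  \prod_i (if T i then 1 else -1).

(** The sum factors over positions: one in [P] is forced into [T] and contributes 1, any other is
    free and contributes 1 - 1 = 0. *)
Lemma alternating_cover d (P : pred 'I_d) :
  \sum_(T : {ffun 'I_d -> bool} | [forall i, P i ==> T i]) subset_sign T
    = [forall i, P i]%:R.
Proof.
have -> : [forall i, P i]%:R = \prod_i (P i)%:R :> k.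
  have [/forallP h|] := boolP [forall i, P i].
    by rewrite big1 // => i _; rewrite h.
  rewrite negb_forall => /existsP[i hi].
  by rewrite (bigD1 i) //= (negbTE hi) mul0r.
transitivity (\prod_i \sum_(b : bool) (if b then 1 else - (~~ P i)%:R : k)).
  rewrite bigA_distr_bigA /= big_mkcond; apply: eq_bigr => T _.
  rewrite /subset_sign; case: ifPn => [/forallP h|].
    apply: eq_bigr => i _; case: ifPn => // hT.
    by have := h i; rewrite (negbTE hT) implybF => ->.
  rewrite negb_forall => /existsP[i]; rewrite negb_imply => /andP[hP hT].
  by rewrite (bigD1 i) //= (negbTE hT) hP oppr0 mul0r.
by apply: eq_bigr => i _; rewrite big_bool /=; case: (P i); rewrite ?subr0 ?subrr.
Qed.

(** The polarizing substitution: [L] labels the positions by variables, and each variable becomes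
    the sum of the [Y i] over its own positions in [T]. *)
Definition letter_sum d m (L : 'I_d -> 'I_m) (Y : 'I_d -> H)
    (T : {ffun 'I_d -> bool}) (j : 'I_m) : H := \sum_(i | T i && (L i == j)) Y i.

(** Expanding the substituted word gives one product for each map [phi] from its letters to
    compatible positions in [T]; by [alternating_cover] the signed sum over [T] keeps only the
    surjective [phi]. *)
Lemma polarized_word d m (L : 'I_d -> 'I_m) (Y : 'I_d -> H) l (t : l.-tuple 'I_m) :
  \sum_T subset_sign T *: eval_word (letter_sum L Y T) t =
  \sum_(phi : {ffun 'I_l -> 'I_d} | [forall a, L (phi a) == tnth t a] &&
      [forall i, i \in codom phi]) \prod_a Y (phi a).
Proof.
pose good (phi : {ffun 'I_l -> 'I_d}) := [forall a, L (phi a) == tnth t a].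
have exT T : eval_word (letter_sum L Y T) t =
    \sum_(phi : {ffun 'I_l -> 'I_d} | good phi && [forall i, (i \in codom phi) ==> T i])
      \prod_a Y (phi a).
  rewrite /eval_word big_tuple bigA_distr_big_dep; apply: eq_bigl => phi.
  apply/familyP/andP => [h|[/forallP h1 /forallP h2] a].
    split; apply/forallP => i; first by have /andP[] := h i.
    by apply/implyP => /codomP[a ->]; have /andP[] := h a.
  by apply/andP; split => //; apply: (implyP (h2 _)); apply: codom_f.
under eq_bigr do rewrite exT scaler_sumr.
rewrite (exchange_big_dep good) /=; last by move=> T phi _ /andP[].
rewrite [RHS]big_mkcondr; apply: eq_bigr => phi gphi.
under eq_bigl => T do rewrite gphi /=.
rewrite -scaler_suml alternating_cover.
by case: ifP => _; rewrite ?scale1r ?scale0r.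
Qed.

(** At most [d] letters cover [d] positions only if there are exactly [d] of them and [phi] is a
    bijection; so shorter words vanish, and a word of length [d] must be a rearrangement of the
    labels. *)
Lemma polarized_short d m (L : 'I_d -> 'I_m) (Y : 'I_d -> H) (w : seq 'I_m) :
  (size w <= d)%N ->
  \sum_T subset_sign T *: eval_word (letter_sum L Y T) w =
  \sum_(phi : {ffun 'I_d -> 'I_d} | injectiveb phi && (w == map (L \o phi) (enum 'I_d)))
     \prod_a Y (phi a).
Proof.
have sizew (phi : {ffun 'I_d -> 'I_d}) : size (map (L \o phi) (enum 'I_d)) = d.
  by rewrite size_map size_enum_ord.
rewrite leq_eqVlt => /orP[/eqP sw|sw].
  have -> : w = Tuple (introT eqP sw) by [].
  rewrite polarized_word; apply: eq_bigl => phi; rewrite andbC; congr andb.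
    apply/forallP/injectiveP => [h|inj i].
      have /image_injP inj : #|image phi 'I_d| == #|'I_d|.
        by apply/eqP; apply: eq_card => i; rewrite h.
      by move=> a b; apply: inj.
    have [g gK kg] := injF_bij inj; rewrite -(kg i); exact: codom_f.
  rewrite /=; apply/forallP/eqP => [h|e a].
    have {1}-> : w = map (tnth (Tuple (introT eqP sw))) (enum 'I_d).
      by have := map_tnth_enum (Tuple (introT eqP sw)).
    by apply: eq_map => a /=; rewrite (eqP (h a)).
  rewrite (tnth_nth (L a)) /= e (nth_map a) ?size_enum_ord //.
  by rewrite nth_ord_enum.
rewrite [RHS]big_pred0; last first.
  by move=> phi; apply: contraTF sw => /andP[_ /eqP->]; rewrite sizew ltnn.
have -> : w = in_tuple w by [].
rewrite polarized_word big_pred0 // => phi; apply: contraTF sw => /andP[_ /forallP h]; rewrite -leqNgt.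
have := leq_image_card phi xpredT; rewrite card_ord.
have -> : #|codom phi| = #|'I_d| by apply: eq_card => i; rewrite h.
by rewrite card_ord.
Qed.

(* Inclusion-exclusion over the positions of a longest word [w0] of the
   identity: the words shorter than [w0] cancel. *)
Lemma PI_multilinear : PI_algebra H ->
  exists d (c : {ffun 'I_d -> 'I_d} -> k), c [ffun i => i] != 0 /\
    forall Y : 'I_d -> H,
      \sum_(phi : {ffun 'I_d -> 'I_d} | injectiveb phi) c phi *: \prod_a Y (phi a) = 0.
Proof.
case=> m [f [uf nf hf]].
pose f' := [seq p <- f | p.1 != 0].
have hf' (h : 'I_m -> H) : \sum_(p <- f') p.1 *: eval_word h p.2 = 0.
  rewrite big_filter -[RHS](hf h) [in LHS]big_mkcond; apply: eq_bigr => p _.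
  by case: ifPn => // /negPn/eqP ->; rewrite scale0r.
have [p0 p0f' maxp] : exists2 p0, p0 \in f' & forall p, p \in f' -> (size p.2 <= size p0.2)%N.
  have : f' != [::] by rewrite -size_eq0 size_filter -lt0n -has_count.
  elim: f' {hf'} => // p s IH _; case: (altP (s =P [::])) => [->|ns].
    by exists p; rewrite ?mem_head // => q; rewrite inE => /eqP ->.
  have [q qs qm] := IH ns; case: (leqP (size q.2) (size p.2)) => hpq.
    exists p; rewrite ?mem_head // => r; rewrite inE => /orP[/eqP->//|/qm].
    by move=> /leq_trans; apply.
  exists q; first by rewrite inE qs orbT.
  by move=> r; rewrite inE => /orP[/eqP->|/qm//]; apply: ltnW.
pose d := size p0.2; pose L := tnth (in_tuple p0.2).
(* The coefficient of [phi] collects the words that spell the labels of the longest word permuted by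
   [phi]. For the identity this is that word alone, since the words of [f] are distinct. *)
exists d, (fun phi => \sum_(p <- f' | p.2 == map (L \o phi) (enum 'I_d)) p.1).
split.
  have -> : map (L \o [ffun i => i]) (enum 'I_d) = p0.2.
    rewrite -[RHS](map_tnth_enum (in_tuple p0.2)); apply: eq_map => a /=.
    by rewrite ffunE.
  have uf' : uniq (map snd f') by apply: subseq_uniq uf; apply/map_subseq/filter_subseq.
  rewrite (big_rem p0) //= eqxx big_seq_cond big_pred0 ?addr0.
    by move: p0f'; rewrite mem_filter => /andP[].
  move=> p; apply/negbTE; rewrite negb_and -implybE; apply/implyP => pr.
  apply/negP => /eqP pe.
  have := perm_uniq (perm_map snd (perm_to_rem p0f')); rewrite uf' /= => /esym.
  by rewrite -pe map_f.
move=> Y.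
under eq_bigr do rewrite scaler_suml.
rewrite (exchange_big_dep xpredT) //=.
transitivity (\sum_T subset_sign T *: \sum_(p <- f') p.1 *: eval_word (letter_sum L Y T) p.2);
  last by rewrite big1 // => T _; rewrite hf' scaler0.
under [RHS]eq_bigr do rewrite scaler_sumr.
rewrite [RHS]exchange_big /= [LHS]big_seq [RHS]big_seq; apply: eq_bigr => p pf.
under [RHS]eq_bigr do rewrite scalerA mulrC -scalerA.
rewrite -[RHS]scaler_sumr polarized_short ?maxp // scaler_sumr.
by apply: eq_bigl => phi; rewrite andbC.
Qed.

End Multilinear.

(** * Ore extensions: normal forms and leading coefficients *)

Section Subalgebra.
Variables (k : fieldType) (H : algType k).

Definition is_subalg (B : H -> Prop) : Prop :=
  [/\ B 1, (forall a b, B a -> B b -> B (a + b)),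
      (forall (c : k) a, B a -> B (c *: a)) & (forall a b, B a -> B b -> B (a * b))].

Definition poly_in (B : H -> Prop) (p : {poly H}) : Prop := forall i, B p`_i.

(** Elements of the Ore extension are stored with coefficients on the left, as values of [{poly H}].
    There ['X] is central, so evaluation at [x] is not multiplicative and products go through
    [skew_mul]. *)
Definition ore_span (B : H -> Prop) (x : H) : H -> Prop :=
  fun h => exists2 p, poly_in B p & h = p.[x].

Definition comm_domain (B : H -> Prop) : Prop :=
  (forall a b, B a -> B b -> a * b = b * a) /\
  (forall a b, B a -> B b -> a != 0 -> b != 0 -> a * b != 0).

Definition left_free (B : H -> Prop) (x : H) : Prop :=
  forall p, poly_in B p -> p.[x] = 0 -> p = 0.

Variable B : H -> Prop.
Hypothesis hB : is_subalg B.

Lemma sub1 : B 1. Proof. by case: hB. Qed.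
Lemma subD a b : B a -> B b -> B (a + b). Proof. by case: hB => _ h _ _; apply: h. Qed.
Lemma subZ c a : B a -> B (c *: a). Proof. by case: hB => _ _ h _; apply: h. Qed.
Lemma subM a b : B a -> B b -> B (a * b). Proof. by case: hB => _ _ _ h; apply: h. Qed.
Lemma sub0 : B 0. Proof. by rewrite -(scale0r 1); apply/subZ/sub1. Qed.
Lemma subN a : B a -> B (- a). Proof. by rewrite -scaleN1r; apply: subZ. Qed.
Lemma subB a b : B a -> B b -> B (a - b). Proof. by move=> ? ?; apply/subD/subN. Qed.
Lemma subX a n : B a -> B (a ^+ n).
Proof. by move=> Ba; elim: n => [|n IH]; [apply: sub1 | rewrite exprS; apply: subM]. Qed.
Lemma sub_sum (I : Type) (s : seq I) (P : pred I) (F : I -> H) :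
  (forall i, P i -> B (F i)) -> B (\sum_(i <- s | P i) F i).
Proof. by move=> h; apply: big_ind => //; [apply: sub0 | apply: subD]. Qed.

Lemma poly_in0 : poly_in B 0. Proof. by move=> i; rewrite coef0; apply: sub0. Qed.
Lemma poly_inC c : B c -> poly_in B c%:P.
Proof. by move=> Bc i; rewrite coefC; case: ifP => // _; apply: sub0. Qed.
Lemma poly_inD p q : poly_in B p -> poly_in B q -> poly_in B (p + q).
Proof. by move=> hp hq i; rewrite coefD; apply: subD. Qed.
Lemma poly_inCM c p : B c -> poly_in B p -> poly_in B (c%:P * p).
Proof. by move=> hc hp i; rewrite coefCM; apply: subM. Qed.
Lemma poly_inB p q : poly_in B p -> poly_in B q -> poly_in B (p - q).
Proof. by move=> hp hq i; rewrite coefB; apply: subB. Qed.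
Lemma poly_inZ (c : k) p : poly_in B p -> poly_in B ((c *: 1)%:P * p).
Proof. by apply/poly_inCM/subZ/sub1. Qed.
Lemma poly_inMX p : poly_in B p -> poly_in B (p * 'X).
Proof. by move=> hp i; rewrite coefMX; case: ifP => // _; apply: sub0. Qed.
Lemma poly_inX : poly_in B 'X.
Proof. by rewrite -['X]mul1r; apply/poly_inMX/(poly_inC sub1). Qed.
Lemma poly_in_drop n p : poly_in B p -> poly_in B (drop_poly n p).
Proof. by move=> hp i; rewrite coef_drop_poly. Qed.

Lemma poly_dropX (p : {poly H}) : p = drop_poly 1 p * 'X + (p`_0)%:P.
Proof.
by apply/polyP => -[|i]; rewrite coefD coefMX coefC ?add0r //= addr0 coef_drop_poly addn1.
Qed.

Lemma size_drop1 n (p : {poly H}) : (size p <= n.+1)%N -> (size (drop_poly 1 p) <= n)%N.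
Proof. by rewrite size_drop_poly leq_subLR add1n. Qed.

Lemma horner_polyCM c (p : {poly H}) y : (c%:P * p).[y] = c * p.[y].
Proof. by rewrite mul_polyC -[in RHS]hornerZ. Qed.

Lemma size_linear (u e : H) : (size (u%:P * 'X + e%:P)%R <= 2)%N.
Proof. by rewrite size_MXaddC; case: ifP => // _; rewrite ltnS size_polyC_leq1. Qed.

Lemma size_ltW n (p : {poly H}) : (size p <= n.+1)%N -> p`_n = 0 -> (size p <= n)%N.
Proof.
move=> sp pn; apply/leq_sizeP => j; rewrite leq_eqVlt => /orP[/eqP <- //|nj].
by apply: nth_default; apply: leq_trans nj.
Qed.

Lemma span_sub a y : B a -> ore_span B y a.
Proof. by move=> Ba; exists a%:P; [apply: poly_inC | rewrite hornerC]. Qed.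
Lemma span_var y : ore_span B y y.
Proof. by exists 'X; [apply: poly_inX | rewrite hornerX]. Qed.

Section Skew.
Variables (sigma delta : H -> H) (y : H).
Hypotheses (hs : is_alg_aut_on B sigma) (hd : is_sigma_der_on B sigma delta)
  (hy : forall r, B r -> y * r - sigma r * y = delta r).

Lemma autS a : B a -> B (sigma a). Proof. by case: hs => h *; apply: h. Qed.
Lemma autD a b : B a -> B b -> sigma (a + b) = sigma a + sigma b.
Proof. by case: hs => _ h *; apply: h. Qed.
Lemma autZ c a : B a -> sigma (c *: a) = c *: sigma a.
Proof. by case: hs => _ _ h *; apply: h. Qed.
Lemma autM a b : B a -> B b -> sigma (a * b) = sigma a * sigma b.
Proof. by case: hs => _ _ _ h *; apply: h. Qed.
Lemma aut1 : sigma 1 = 1. Proof. by case: hs => _ _ _ _ []. Qed.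
Lemma autI a b : B a -> B b -> sigma a = sigma b -> a = b.
Proof. by case: hs => _ _ _ _ [_ h _]; apply: h. Qed.
Lemma aut0 : sigma 0 = 0.
Proof. by rewrite -(scale0r 1) autZ ?scale0r //; apply: sub1. Qed.
Lemma aut_neq0 a : B a -> a != 0 -> sigma a != 0.
Proof. by move=> Ba; apply: contra_neq => e; apply: autI; rewrite ?aut0 //; apply: sub0. Qed.
Lemma autN a : B a -> sigma (- a) = - sigma a.
Proof. by move=> Ba; rewrite -scaleN1r autZ // scaleN1r. Qed.
Lemma iter_autS n a : B a -> B (iter n sigma a).
Proof. by move=> Ba; elim: n => //= n; apply: autS. Qed.
Lemma iter_autI n a b : B a -> B b -> iter n sigma a = iter n sigma b -> a = b.
Proof. by move=> Ba Bb; elim: n => //= n IH e; apply/IH/autI => //; apply: iter_autS. Qed.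
Lemma iter_aut0 n : iter n sigma 0 = 0. Proof. by elim: n => //= n ->; apply: aut0. Qed.
Lemma iter_neq0 n a : B a -> a != 0 -> iter n sigma a != 0.
Proof. by move=> Ba; apply: contra_neq => e; apply: (@iter_autI n); rewrite ?iter_aut0 //; apply: sub0. Qed.
Lemma iter_autD n a b : B a -> B b -> iter n sigma (a + b) = iter n sigma a + iter n sigma b.
Proof. by move=> Ba Bb; elim: n => //= n ->; rewrite autD //; apply: iter_autS. Qed.
Lemma iter_autZ n c a : B a -> iter n sigma (c *: a) = c *: iter n sigma a.
Proof. by move=> Ba; elim: n => //= n ->; rewrite autZ //; apply: iter_autS. Qed.
Lemma derS a : B a -> B (delta a). Proof. by case: hd => h *; apply: h. Qed.
Lemma derM a b : B a -> B b -> delta (a * b) = sigma a * delta b + delta a * b.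
Proof. by case: hd => _ _ _ h *; apply: h. Qed.

Lemma skewE r : B r -> y * r = sigma r * y + delta r.
Proof. by move=> Br; rewrite -hy // addrC subrK. Qed.

Lemma skew_mulC n p a : poly_in B p -> (size p <= n.+1)%N -> B a ->
  exists r, [/\ poly_in B r, (size r <= n.+1)%N, r`_n = p`_n * iter n sigma a
    & p.[y] * a = r.[y]].
Proof.
elim: n p a => [|n IH] p a hp sp Ba.
  exists (p`_0 * a)%:P; split=> /=; rewrite ?coefC ?hornerC //.
  - by apply/poly_inC/subM.
  - by apply: leq_trans (size_polyC_leq1 _) _.
  - by rewrite {1}(size1_polyC sp) hornerC.
have hq := poly_in_drop 1 hp; have sq := size_drop1 sp.
have [r1 [h1 s1 c1 e1]] := IH _ _ hq sq (autS Ba).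
have [r2 [h2 s2 c2 e2]] := IH _ _ hq sq (derS Ba).
(* With [p = p' * 'X + p_0], the product is [p' (sigma a) y + p' (delta a) + p_0 a]; the induction
   hypothesis normalizes the first two terms. *)
exists (r1 * 'X + r2 + (p`_0 * a)%:P); split.
- by do 2?apply: poly_inD => //; [apply: poly_inMX | apply/poly_inC/subM].
- apply: leq_trans (size_polyD _ _) _; rewrite geq_max (leq_trans (size_polyC_leq1 _)) // andbT.
  apply: leq_trans (size_polyD _ _) _; rewrite geq_max (leq_trans s2) // andbT.
  by apply: leq_trans (size_polyMleq _ _) _; rewrite size_polyX addn2.
- by rewrite !coefD coefMX coefC /= addr0 [r2`_ _]nth_default // addr0 c1 coef_drop_poly addn1 -iterSr.
- rewrite {1}(poly_dropX p) hornerMXaddC mulrDl -mulrA skewE // mulrDr mulrA e1 e2.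
  by rewrite hornerD hornerC hornerD hornerMX.
Qed.

Lemma skew_mul m n p q : poly_in B p -> (size p <= n.+1)%N -> poly_in B q -> (size q <= m.+1)%N ->
  exists r, [/\ poly_in B r, (size r <= (n + m).+1)%N, r`_(n + m) = p`_n * iter n sigma q`_m
    & p.[y] * q.[y] = r.[y]].
Proof.
elim: m q => [|m IH] q hp sp hq sq.
  by rewrite addn0 (size1_polyC sq) coefC hornerC; apply: skew_mulC.
have [r1 [h1 s1 c1 e1]] := IH _ hp sp (poly_in_drop 1 hq) (size_drop1 sq).
have [r2 [h2 s2 c2 e2]] := skew_mulC hp sp (hq 0%N).
exists (r1 * 'X + r2); rewrite addnS; split.
- by apply: poly_inD => //; apply: poly_inMX.
- apply: leq_trans (size_polyD _ _) _; rewrite geq_max (leq_trans s2) ?ltnS ?(leqW (leq_addr _ _)) // andbT.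
  by apply: leq_trans (size_polyMleq _ _) _; rewrite size_polyX addn2.
- rewrite coefD coefMX /= [r2`_ _]nth_default ?addr0 ?c1 ?coef_drop_poly ?addn1 //.
  by apply: leq_trans s2 _; rewrite ltnS leq_addr.
- by rewrite {1}(poly_dropX q) hornerMXaddC mulrDr mulrA e1 e2 hornerD hornerMX.
Qed.

Lemma span_subalg : is_subalg (ore_span B y).
Proof.
split.
- exact: span_sub sub1.
- by move=> _ _ [p hp ->] [q hq ->]; exists (p + q); [apply: poly_inD | rewrite hornerD].
- move=> c _ [p hp ->]; exists ((c *: 1)%:P * p); first exact: poly_inZ.
  by rewrite horner_polyCM -scalerAl mul1r.
- move=> _ _ [p hp ->] [q hq ->].
  by have [r [hr _ _ e]] := skew_mul hp (leqnSn _) hq (leqnSn _); exists r.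
Qed.

End Skew.
End Subalgebra.

(** * The modules [A / A z] and their faithfulness over a PI algebra *)

Section Action.
Variables (k : fieldType) (H : algType k) (R : H -> Prop) (sigma delta : H -> H) (x : H).
Hypotheses (hR : is_subalg R) (hRd : comm_domain R)
  (hs : is_alg_aut_on R sigma) (hd : is_sigma_der_on R sigma delta)
  (hx : forall r, R r -> x * r - sigma r * x = delta r) (hfree : left_free R x).

Local Notation A := (ore_span R x).
Let hA : is_subalg A := span_subalg hR hs hd hx.

(** For [h != 0] the leading coefficient of [h * (u * x + e)] is a product of nonzero elements of
    the domain [R], in degree one more than that of [h]; such a product cannot lie in [R]. *)
Lemma span_linear_meet u e w h : R u -> u != 0 -> R e -> R w -> A h ->
  w = h * (u * x + e) -> w = 0.
Proof.
move=> Ru u0 Re Rw [p hp ->] ew.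
case: (eqVneq p 0) ew => [->|p0] ew; first by rewrite ew horner0 mul0r.
pose q := u%:P * 'X + e%:P.
have hq : poly_in R q.
  by apply: (poly_inD hR); [apply: (poly_inCM hR Ru (poly_inX hR))|apply: (poly_inC hR Re)].
have sq : (size q <= 2)%N by apply: size_linear.
have eq : q.[x] = u * x + e by rewrite /q hornerMXaddC hornerC.
have sp : (size p <= (size p).-1.+1)%N by rewrite prednK ?size_poly_gt0.
have [r [hr sr cr er]] := skew_mul hR hs hd hx hp sp hq sq.
have : r - w%:P = 0.
  apply: hfree; first by apply: (poly_inB hR) => //; apply: poly_inC.
  by rewrite hornerD hornerN hornerC -er eq -ew subrr.
move/eqP; rewrite subr_eq0 => /eqP er'.
move: cr; rewrite er' coefC addn1 /= -lead_coefE coefD coefCM coefX coefC /= mulr1 addr0.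
move=> /esym e0; exfalso; move: e0; apply/eqP; have [_ dom] := hRd; apply: (dom) => //.
- exact: hp.
- exact: (iter_autS hs).
- by rewrite lead_coef_eq0.
- exact: (iter_neq0 hR hs).
Qed.

Section Module.
Variable z : H.
Hypothesis hz : exists u e, [/\ R u, u != 0, R e & z = u * x + e].

(* [act p v w] says that [p] sends [v] to [w] in the module [A / A z], where [R]
   embeds by [span_linear_meet]. *)
Definition act (p v w : H) : Prop := exists2 h, A h & p * v - w = h * z.

Lemma act_uniq p v w w' : R w -> R w' -> act p v w -> act p v w' -> w = w'.
Proof.
move=> Rw Rw' [h hh e] [h' hh' e']; have [u [f [Ru u0 Rf zE]]] := hz.
apply/eqP; rewrite -subr_eq0; apply/eqP.
apply: (span_linear_meet Ru u0 Rf _ (subB hA hh' hh)); first exact: subB.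
by rewrite -zE mulrBl -e -e' opprB [RHS]addrC addrA subrK.
Qed.

Lemma act_sum (I : Type) (s : seq I) (P : pred I) (c : I -> k) (p w : I -> H) v :
  (forall i, P i -> act (p i) v (w i)) ->
  act (\sum_(i <- s | P i) c i *: p i) v (\sum_(i <- s | P i) c i *: w i).
Proof.
move=> h; apply: (big_rec2 (fun a b => act a v b)).
  by exists 0; [apply: sub0 | rewrite mul0r subrr mul0r].
move=> i a b Pi [g hg e]; have [g' hg' e'] := h i Pi.
exists (c i *: g' + g); first by apply: (subD hA) => //; apply: subZ.
by rewrite [RHS]mulrDl -[in RHS]scalerAl -e' -e mulrDl -scalerAl scalerBr opprD addrACA.
Qed.

Lemma act0 p v : act p 0 0 /\ act 0 v 0.
Proof. by split; exists 0; rewrite ?mulr0 ?mul0r ?subrr //; apply: sub0. Qed.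

Lemma act_comp p q v w w' : A q -> act p v w -> act q w w' -> act (q * p) v w'.
Proof.
move=> Aq [h hh e] [g hg f]; exists (q * h + g); first by apply: (subD hA) => //; apply: subM.
by rewrite [RHS]mulrDl -[q * h * z]mulrA -e -f mulrBr addrA subrK mulrA.
Qed.

Lemma act_mul a v : act a v (a * v).
Proof. by exists 0; [apply: sub0 | rewrite subrr mul0r]. Qed.

Lemma act_add p q v w w' : act p v w -> act q v w' -> act (p + q) v (w + w').
Proof.
move=> [h hh e] [g hg f]; exists (h + g); first exact: subD.
by rewrite !mulrDl -e -f opprD addrACA.
Qed.

Lemma act_opp p v w : act p v w -> act (- p) v (- w).
Proof. by case=> h hh e; exists (- h); [apply: subN | rewrite !mulNr -e opprB opprK addrC]. Qed.

Variables (y : H) (theta sigma' delta' : H -> H).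
Hypotheses (Ay : A y) (Rtheta : forall v, R v -> R (theta v))
  (hact : forall v, R v -> act y v (theta v))
  (hs' : is_alg_aut_on R sigma') (hd' : is_sigma_der_on R sigma' delta')
  (hy : forall r, R r -> y * r - sigma' r * y = delta' r).

Lemma span_horner p : poly_in R p -> A p.[y].
Proof.
move=> hp; rewrite horner_coef; apply: (sub_sum hA) => i _.
by apply/(subM hA)/(subX hA) => //; apply: span_sub.
Qed.

Lemma act_poly p v : poly_in R p -> R v -> exists2 w, R w & act p.[y] v w.
Proof.
have [n sp] := ubnP (size p); elim: n p v sp => // n IH p v sp hp Rv.
have [->|p0] := eqVneq p 0.
  by exists 0; [apply: sub0 | rewrite horner0; case: (act0 0 v)].
have hq := poly_in_drop 1 hp.
have sq : (size (drop_poly 1 p) < n)%N.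
  by rewrite size_drop_poly subn1 prednK ?size_poly_gt0.
have [w Rw hw] := IH _ _ sq hq (Rtheta Rv).
exists (w + p`_0 * v); first by apply/(subD hR)/(subM hR) => //; apply: hp.
rewrite (poly_dropX p) hornerMXaddC coefD coefMX coefC /= add0r.
apply: act_add; last exact: act_mul.
by apply: act_comp (hact Rv) hw; apply: span_horner.
Qed.

Hypothesis faithful : forall p, poly_in R p -> p != 0 ->
  exists v w, [/\ R v, R w, w != 0 & act p.[y] v w].

(* The [P a] are built so that among the products of distinct ones only
   [P (s-1) * ... * P 0] does not kill [v 0]. *)
Lemma staircase s : exists (P v : nat -> H),
  (exists p w, [/\ poly_in R p, R w, w != 0 &
     (forall t, (t < s)%N -> act p.[y] (v t) 0) /\ act p.[y] (v s) w]) /\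
  (forall a, (a < s)%N -> [/\ A (P a), act (P a) (v a) (v a.+1) &
      forall t, (t < a)%N -> act (P a) (v t) 0]) /\
  (forall a, (a <= s)%N -> R (v a) /\ v a != 0).
Proof.
elim: s => [|s [P [v [[p [w [hp Rw w0 [hk hw]]]] [hP hv]]]]].
  exists (fun _ => 0), (fun _ => 1); split; last first.
    by split=> // a _; split; [apply: sub1 | apply: oner_neq0].
  exists 1, 1; split; rewrite ?oner_neq0 //; first by apply: poly_inC (sub1 _).
    exact: sub1.
  by split=> //; rewrite hornerC -[X in act _ _ X]mulr1; apply: act_mul.
(* The operator [w * y - theta w] kills [w] because [R] is commutative, so [q.[y] * p.[y]] kills
   [v s] in addition to the earlier vectors. *)
pose q := w%:P * 'X + (- theta w)%:P.
have hq : poly_in R q.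
  by apply: (poly_inD hR); [apply: (poly_inCM hR Rw (poly_inX hR))|apply/(poly_inC hR)/(subN hR)/Rtheta].
have eq : q.[y] = w * y - theta w by rewrite hornerMXaddC hornerC.
have qw : act q.[y] w 0.
  rewrite eq; have -> : 0 = w * theta w - theta w * w.
    by have [cm _] := hRd; rewrite cm ?subrr //; apply: Rtheta.
  apply: act_add; last by rewrite -mulNr; apply: act_mul.
  by apply: act_comp (hact Rw) (act_mul _ _); apply: span_sub.
have p0 : p != 0.
  apply: contra_neq w0 => p0; apply: (act_uniq Rw (sub0 hR) hw).
  by rewrite p0 horner0; case: (act0 0 (v s)).
have sp : (size p <= (size p).-1.+1)%N by rewrite prednK ?size_poly_gt0.
have [r [hr sr cr er]] := skew_mul hR hs' hd' hy hq (size_linear _ _) hp sp.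
(* The operator [q.[y] * p.[y] * w] is nonzero by its leading coefficient, so faithfulness yields
   [c] that it does not kill. Then [c * p.[y]] carries [v s] to the new vector [c * w], on which
   [q.[y] * p.[y]] does not vanish. *)
have [r2 [hr2 _ cr2 er2]] := skew_mulC hR hs' hd' hy hr sr Rw.
have dom : forall a b, R a -> R b -> a != 0 -> b != 0 -> a * b != 0 by case: hRd.
have r20 : r2 != 0.
  apply/eqP => r20.
  move: cr2; rewrite r20 coef0 cr coefD coefCM coefX coefC /= mulr1 addr0.
  move=> /esym; apply/eqP; apply: (dom) => //.
  - by apply/(subM hR)/(autS hs')/hp.
  - exact: (iter_autS hs' (1 + (size p).-1) Rw).
  - by apply: (dom) => //; [apply/(autS hs')/hp|apply: (aut_neq0 hR hs'); rewrite -?lead_coefE ?lead_coef_eq0 //; apply: hp].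
  - exact: (@iter_neq0 _ _ _ hR _ hs' (1 + (size p).-1) _ Rw).
have [c [w2 [Rc Rw2 w20 hw2]]] := faithful hr2 r20.
have c0 : c != 0.
  apply: contra_neq w20 => c0; apply: (act_uniq Rw2 (sub0 hR) hw2).
  by rewrite c0; case: (act0 r2.[y] c).
exists (fun a => if a == s then c * p.[y] else P a),
       (fun a => if a == s.+1 then c * w else v a); split; [|split].
- exists r, w2; split=> //; split.
    move=> t; rewrite ltnS leq_eqVlt => /orP[/eqP ->|ts].
      by rewrite (ltn_eqF (ltnSn s)) -er; apply: act_comp hw qw; apply: span_horner.
    rewrite (ltn_eqF (leqW ts)) -er; apply: act_comp (hk _ ts) _; first exact: span_horner.
    by case: (act0 q.[y] 0).
  rewrite eqxx; have [cm _] := hRd; rewrite cm //.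
  by case: hw2 => h hh e; exists h => //; rewrite -e -er2 mulrA.
- move=> a; rewrite ltnS leq_eqVlt => /orP[/eqP ->|as_].
    rewrite eqxx (ltn_eqF (ltnSn s)) eqxx; split.
    + by apply: (subM hA); [apply: span_sub|apply: span_horner].
    + by apply: act_comp hw (act_mul _ _); apply: span_sub.
    + move=> t ts; rewrite (ltn_eqF (leqW ts)).
      by apply: act_comp (hk _ ts) _; [apply: span_sub | case: (act0 c 0)].
  have [h1 h2 h3] := hP _ as_.
  rewrite (ltn_eqF as_) (ltn_eqF (leqW as_)) eqSS (ltn_eqF as_); split=> // t ta.
  by rewrite (ltn_eqF (leqW (ltn_trans ta as_))); apply: h3.
- move=> a; rewrite leq_eqVlt => /orP[/eqP ->|as_].
    by rewrite eqxx; split; [apply: subM | apply: (dom)].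
  by rewrite (ltn_eqF as_); apply: hv.
Qed.

(** The rightmost letter acts first. Once the letters [0, ..., m-1] have led to [v m], a new letter
    [j] satisfies [j >= m]: either [j = m] and the climb continues, or [j > m] and [v m] is
    killed. *)
Lemma act_word s (P v : nat -> H) (w : seq nat) :
  (forall a, (a < s)%N -> [/\ A (P a), act (P a) (v a) (v a.+1) &
      forall t, (t < a)%N -> act (P a) (v t) 0]) ->
  uniq w -> (forall a, a \in w -> (a < s)%N) ->
  act (\prod_(j <- w) P j) (v 0%N) (if w == rev (iota 0 (size w)) then v (size w) else 0).
Proof.
move=> hP; elim: w => [|j w IH].
  by rewrite big_nil /= -[X in act _ _ X]mul1r => _ _; apply: act_mul.
rewrite cons_uniq => /andP[jw uw] hw.
rewrite big_cons (_ : size (j :: w) = size w + 1)%N ?addn1 // -addn1 iotaD add0n cats1 rev_rcons.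
have [Aj h1 h2] := hP _ (hw _ (mem_head _ _)).
have hw' a : a \in w -> (a < s)%N by move=> aw; apply: hw; rewrite inE aw orbT.
apply: act_comp (IH uw hw') _ => //; rewrite eqseq_cons.
case: eqP => [e|]; last by rewrite andbF; case: (act0 (P j) 0).
rewrite andbT; case: eqP => [<-|/eqP jn]; first by rewrite addn1.
apply: h2; rewrite ltn_neqAle eq_sym jn /= leqNgt; apply: contra jw => jl.
by rewrite e mem_rev mem_iota.
Qed.

(** Evaluating the multilinear identity on the staircase operators leaves only the identity
    permutation, hence a nonzero multiple of [v d], while the identity says that this is zero. *)
Lemma PI_not_faithful : PI_algebra H -> False.
Proof.
move=> /PI_multilinear[d [c [c0 hc]]].
have [P [v [_ [hP hv]]]] := staircase d.
(* Positions are reversed since the last factor of a product is the first to act. *)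
pose Y (i : 'I_d) := P (rev_ord i).
pose w (phi : {ffun 'I_d -> 'I_d}) := [seq val (rev_ord (phi a)) | a <- enum 'I_d].
have sw phi : size (w phi) = d by rewrite size_map size_enum_ord.
have hw (phi : {ffun 'I_d -> 'I_d}) : injectiveb phi ->
    act (\prod_a Y (phi a)) (v 0%N) (if w phi == rev (iota 0 d) then v d else 0).
  move=> /injectiveP inj.
  have -> : \prod_a Y (phi a) = \prod_(j <- w phi) P j by rewrite /w big_map enumT [index_enum _]unlock.
  have := act_word (w := w phi) hP; rewrite sw; apply.
    by rewrite map_inj_uniq ?enum_uniq // => a b /val_inj/rev_ord_inj/inj.
  by move=> a /mapP[b _ ->]; apply: ltn_ord.
have wid (phi : {ffun 'I_d -> 'I_d}) : (w phi == rev (iota 0 d)) = (phi == [ffun i => i]).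
  have -> : rev (iota 0 d) = w [ffun i => i].
    apply: (@eq_from_nth _ 0%N); rewrite size_rev size_iota ?sw // => i ld.
    rewrite nth_rev size_iota // nth_iota ?add0n; last by rewrite subnSK // leq_subr.
    by rewrite (nth_map (Ordinal ld)) ?size_enum_ord // ffunE /= nth_enum_ord.
  apply/eqP/eqP => [e|-> //]; apply/ffunP => i; apply/rev_ord_inj/val_inj.
  by move/eq_in_map: e => /(_ i (mem_enum _ _)).
have : act 0 (v 0%N) (c [ffun i => i] *: v d).
  have -> : c [ffun i => i] *: v d = \sum_(phi : {ffun 'I_d -> 'I_d} | injectiveb phi)
      c phi *: (if w phi == rev (iota 0 d) then v d else 0).
    rewrite (bigD1 [ffun i => i]) /=; last by apply/injectiveP => a b; rewrite !ffunE.
    rewrite big1 => [|phi /andP[_ np]]; last by rewrite wid (negbTE np) scaler0.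
    by rewrite wid eqxx addr0.
  by have := act_sum (index_enum _) c hw; rewrite hc.
have [Rvd vd0] := hv _ (leqnn d).
have [_ a00] := act0 0 (v 0%N).
move=> /(act_uniq (subZ hR _ Rvd) (sub0 hR))/(_ a00)/eqP.
by rewrite scaler_eq0 (negbTE c0) (negbTE vd0).
Qed.

End Module.

End Action.

(** * Consequences of a polynomial identity for one Ore step *)

Section Faithful.
Variables (k : fieldType) (H : algType k) (R : H -> Prop) (sigma delta : H -> H) (x : H).
Hypotheses (hR : is_subalg R) (hRd : comm_domain R)
  (hs : is_alg_aut_on R sigma) (hd : is_sigma_der_on R sigma delta)
  (hx : forall r, R r -> x * r - sigma r * x = delta r) (hfree : left_free R x).

Local Notation A := (ore_span R x).
Local Notation act z := (act R x z).
Let hA : is_subalg A := span_subalg hR hs hd hx.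

Lemma commutes a b : R a -> R b -> a * b = b * a. Proof. by case: hRd => h _; apply: h. Qed.
Lemma domain a b : R a -> R b -> a != 0 -> b != 0 -> a * b != 0.
Proof. by case: hRd => _ h; apply: h. Qed.

(** * Trivial automorphism: the derivation vanishes in characteristic 0 *)

Section Derivation.
Hypothesis sigma_id : forall a, R a -> sigma a = a.

(** The commutator of [x ^+ n] with [a] is [n (delta a) x ^+ n.-1] plus lower terms. For [n = 0] the
    coefficient formula reads 0 = 0. *)
Lemma skew_commutator n p a : poly_in R p -> (size p <= n.+1)%N -> R a ->
  exists q, [/\ poly_in R q, (size q <= n)%N, q`_n.-1 = p`_n * delta a *+ n
    & p.[x] * a - a * p.[x] = q.[x]].
Proof.
move=> hp sp Ra; elim: n p hp sp => [|n IH] p hp sp.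
  exists 0; rewrite size_poly0 coef0 horner0 (size1_polyC sp) hornerC; split=> //.
    exact: poly_in0.
  by rewrite (commutes Ra) ?subrr.
have hq := poly_in_drop 1 hp; have sq := size_drop1 sp.
have [q [h1 s1 c1 e1]] := IH _ hq sq.
have [r [h2 s2 c2 e2]] := skew_mulC hR hs hd hx hq sq (derS hd Ra).
exists (q * 'X + r); split.
- by apply: (poly_inD hR) => //; apply: (poly_inMX hR).
- apply: leq_trans (size_polyD _ _) _; rewrite geq_max s2 andbT.
  by apply: leq_trans (size_polyMleq _ _) _; rewrite size_polyX addn2.
- rewrite /= coefD coefMX; case: n {IH} sq c1 s1 c2 s2 sp => [|n] sq c1 s1 c2 s2 sp /=.
    by rewrite add0r c2 coef_drop_poly /= mulr1n.
  have -> : r`_n.+1 = p`_n.+2 * delta a.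
    rewrite c2 coef_drop_poly addn1; congr (_ * _).
    by elim: n.+1 => //= m ->; apply: sigma_id; apply: (derS hd).
  by rewrite c1 coef_drop_poly addn1 [RHS]mulrSr.
- rewrite {1 2}(poly_dropX p) hornerMXaddC mulrDl mulrDr -mulrA (skewE hx Ra) sigma_id //.
  rewrite mulrDr mulrA e2 (commutes (hp 0%N) Ra) addrAC opprD addrA.
  rewrite hornerD hornerMX -e1 mulrBl -!mulrA [in RHS]addrAC.
  by rewrite addrAC [_ + r.[x] - _]addrAC addrK addrAC.
Qed.

(** If [p] kills [R], so does its commutator with [a], of smaller degree and therefore zero by
    induction. Its leading coefficient [n p_n (delta a)] then vanishes, so [p_n = 0] when [n > 0]; a
    constant is tested on 1. *)
Lemma der_faithful a n p : [pchar k] =i pred0 -> R a -> delta a != 0 ->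
  poly_in R p -> (size p <= n)%N -> (forall v, R v -> act x p.[x] v 0) -> p = 0.
Proof.
move=> char0 Ra da; elim: n p => [|n IH] p hp sp kill.
  by apply/eqP; rewrite -size_poly_leq0.
have hz : exists u e, [/\ R u, u != 0, R e & x = u * x + e].
  by exists 1, 0; split; rewrite ?oner_neq0 ?mul1r ?addr0 //; [apply: sub1 | apply: sub0].
have [q [hq sq cq eq]] := skew_commutator hp sp Ra.
have q0 : q = 0.
  apply: IH => // v Rv; rewrite -eq.
  rewrite -[X in act _ _ _ X]addr0 -[X in act _ _ _ (_ + X)]oppr0.
  apply: (act_add hR hs hd hx); last first.
    apply: (act_opp hR hs hd hx); apply: (act_comp hR hs hd hx) (kill _ Rv) _.
      by apply: span_sub.
    by case: (act0 hR hs hd hx x a 0).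
  by have [h hh e] := kill _ (subM hR Ra Rv); exists h => //; rewrite -mulrA.
case: n => [|n] in IH sp sq cq *.
  move: (kill 1 (sub1 hR)); rewrite (size1_polyC sp) hornerC => hk.
  have := act_mul hR hs hd hx x (p`_0) 1; rewrite mulr1 => hk'.
  by rewrite (act_uniq hR hRd hs hd hx hfree hz _ _ hk' hk) //; apply: sub0.
have pn : p`_n.+1 = 0.
  apply/eqP; apply: contraT => pn; move: cq; rewrite q0 coef0 => /esym/eqP.
  rewrite -scaler_nat scaler_eq0 (negbTE (domain _ _ pn da)) //; last exact: (derS hd).
  by rewrite orbF (proj1 (pcharf0P _) char0).
by apply: IH => //; apply: size_ltW pn.
Qed.

(* [A] acts faithfully on [A / A x], that is on [R] through [delta]. *)
Lemma PI_derivation : [pchar k] =i pred0 -> PI_algebra H -> forall a, R a -> delta a = 0.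
Proof.
move=> char0 PI a Ra; apply/eqP; apply: contraT => da; exfalso.
have hz : exists u e, [/\ R u, u != 0, R e & x = u * x + e].
  by exists 1, 0; split; rewrite ?oner_neq0 ?mul1r ?addr0 //; [apply: sub1 | apply: sub0].
have Ax : A x by apply: span_var.
have hact v : R v -> act x x v (delta v).
  by move=> Rv; exists v; [apply: span_sub | rewrite -hx // sigma_id // opprB addrC subrK].
have dS v : R v -> R (delta v) by apply: (derS hd).
apply: (PI_not_faithful hR hRd hs hd hx hfree hz Ax dS hact hs hd hx _ PI).
move=> p hp p0; apply: NNPP => nex; case/eqP: p0.
apply: (der_faithful char0 Ra da hp (leqnn _)) => v Rv.
have [w Rw hw] := act_poly hR hs hd hx Ax dS hact hp Rv.
case: (eqVneq w 0) => [w0|w0]; first by rewrite -w0.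
by case: nex; exists v, w.
Qed.

End Derivation.

(** * Nontrivial automorphism: it has finite order *)

Section Automorphism.
Variable y : H.
Hypotheses (hy : forall r, R r -> y * r = sigma r * y).

Lemma skewX n r : R r -> y ^+ n * r = iter n sigma r * y ^+ n.
Proof.
elim: n r => [|n IH] r Rr; first by rewrite mul1r mulr1.
by rewrite exprS -mulrA IH // mulrA hy ?mulrA //; apply: (iter_autS hs).
Qed.

Hypothesis infinite_order : forall q, (0 < q)%N -> exists2 a, R a & iter q sigma a <> a.
Variable z : H.
Hypotheses (Ay : A y) (hz : exists u e, [/\ R u, u != 0, R e & z = u * x + e])
  (hact : forall v, R v -> act z y v (sigma v)).

(* Dedekind's independence of the distinct powers of [sigma]. *)
Lemma aut_faithful n p :
  poly_in R p -> (size p <= n)%N -> (forall v, R v -> act z p.[y] v 0) -> p = 0.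
Proof.
elim: n p => [|n IH] p hp sp kill.
  by apply/eqP; rewrite -size_poly_leq0.
have low l : (l < n)%N -> p`_l = 0.
  move=> ln; apply/eqP; apply: contraT => pl; exfalso.
  have [b Rb ne] : exists2 a, R a & iter (n - l) sigma a <> a.
    by apply: infinite_order; rewrite subn_gt0.
  (* These are the coefficients of [p b - (iter n sigma b) p], which still kills [R] but has lost
     its term of degree [n]; [b] is chosen so that the coefficient at [l] would survive. *)
  pose q := \poly_(i < n) (p`_i * (iter i sigma b - iter n sigma b)).
  have hq : poly_in R q.
    move=> i; rewrite coef_poly; case: ifP => _; last exact: sub0.
    by apply: (subM hR) (hp _) _; apply: subB => //; apply: (iter_autS hs).
  have q0 : q = 0.
    apply: IH; rewrite ?size_poly // => v Rv.
    have -> : q.[y] = p.[y] * b - iter n sigma b * p.[y].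
      rewrite horner_poly (horner_coef_wide _ sp) mulr_suml mulr_sumr -sumrB big_ord_recr /=.
      rewrite -[p`_n * _ * b]mulrA skewX // [iter n _ _ * (p`_n * _)]mulrA.
      rewrite [iter n _ _ * p`_n](commutes (iter_autS hs n Rb) (hp n)) -!mulrA subrr addr0.
      apply: eq_bigr => i _; rewrite -[p`_i * _ * b]mulrA skewX // mulrA.
      by rewrite [iter n _ _ * _]mulrA (commutes (iter_autS hs n Rb) (hp i)) -mulrBl -mulrBr.
    rewrite -[X in act _ _ _ X]addr0 -[X in act _ _ _ (_ + X)]oppr0.
    apply: (act_add hR hs hd hx); last first.
      apply: (act_opp hR hs hd hx); apply: (act_comp hR hs hd hx) (kill _ Rv) _.
        by apply: span_sub => //; apply: (iter_autS hs).
      by case: (act0 hR hs hd hx z (iter n sigma b) 0).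
    by have [h hh e] := kill _ (subM hR Rb Rv); exists h => //; rewrite -mulrA.
  have /eqP := coef_poly n (fun i => p`_i * (iter i sigma b - iter n sigma b)) l.
  rewrite -/q q0 coef0 ln eq_sym; apply/negP/domain => //.
    by apply: subB => //; apply: (iter_autS hs).
  rewrite subr_eq0; apply/eqP; rewrite -(subnKC (ltnW ln)) iterD => e.
  apply: ne; apply/esym; apply: (iter_autI hs (n := l)) e => //; exact: (iter_autS hs).
have pE : p = (p`_n)%:P * 'X^n.
  apply/polyP => i; rewrite coefCM coefXn; case: ltngtP => [/low ->|ni|->]; rewrite ?mulr0 ?mulr1 //.
  by rewrite nth_default //; apply: leq_trans ni.
have act_yn m : act z (y ^+ m) 1 1.
  elim: m => [|m IHm]; first by rewrite -[X in act _ _ _ X]mul1r; apply: (act_mul hR hs hd hx).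
  have := hact (sub1 hR); rewrite (aut1 hs) exprS.
  exact: (act_comp hR hs hd hx Ay IHm).
have : act z p.[y] 1 p`_n.
  rewrite pE horner_polyCM hornerXn -pE -{2}[p`_n]mulr1.
  by apply: (act_comp hR hs hd hx) (act_yn n) (act_mul hR hs hd hx _ _ _); apply: span_sub.
move=> /(act_uniq hR hRd hs hd hx hfree hz (hp n) (sub0 hR))/(_ (kill _ (sub1 hR))) pn.
by rewrite pE pn mul0r.
Qed.

End Automorphism.

(* After the change of variable [y = (sigma b - b) x + delta b] the derivation
   vanishes; [A] then acts on [A / A (y - 1)], that is on [R] through [sigma]. *)
Lemma PI_automorphism b : PI_algebra H -> R b -> sigma b != b ->
  exists2 q, (0 < q)%N & forall a, R a -> iter q sigma a = a.
Proof.
move=> PI Rb sb; apply: NNPP => nex.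
have inf q : (0 < q)%N -> exists2 a, R a & iter q sigma a <> a.
  move=> q0; apply: NNPP => n2; apply: nex; exists q => // a Ra.
  by apply: NNPP => ne; apply: n2; exists a.
pose u := sigma b - b; pose y := u * x + delta b; pose z := y - 1.
have Ru : R u by apply: subB => //; apply: (autS hs).
have u0 : u != 0 by rewrite subr_eq0.
have Rdb : R (delta b) by apply: (derS hd).
have hy r : R r -> y * r = sigma r * y.
  move=> Rr; have Rsr := autS hs Rr; have Rdr := derS hd Rr.
  (* Obtained by applying [delta] to [b * r = r * b]. *)
  have key : u * delta r + delta b * r = sigma r * delta b.
    have := congr1 delta (commutes Rb Rr); rewrite !(derM hd) // => e.
    by rewrite mulrBl addrAC e (commutes Rb Rdr) addrK.
  rewrite mulrDl -mulrA (skewE hx Rr) mulrDr -addrA key mulrDr !mulrA.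
  by rewrite (commutes Ru Rsr).
have hz : exists u e, [/\ R u, u != 0, R e & z = u * x + e].
  by exists u, (delta b - 1); split=> //; [apply: subB => //; apply: sub1 | rewrite addrA].
have Ay : A y.
  apply: (subD hA); last exact: span_sub.
  by apply: (subM hA); [apply: span_sub | apply: span_var].
have hact v : R v -> act z y v (sigma v).
  move=> Rv; exists (sigma v); first by apply: span_sub => //; apply: (autS hs).
  by rewrite hy // mulrBr mulr1.
have hd' : is_sigma_der_on R sigma (fun _ => 0).
  by split=> *; rewrite ?mulr0 ?mul0r ?addr0 ?scaler0 //; apply: sub0.
have hy' r : R r -> y * r - sigma r * y = 0 by move=> Rr; rewrite hy // subrr.
have sS v : R v -> R (sigma v) by apply: (autS hs).
apply: (PI_not_faithful hR hRd hs hd hx hfree hz Ay sS hact hs hd' hy' _ PI).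
move=> p hp p0; apply: NNPP => nex'; case/eqP: p0.
apply: (aut_faithful hy inf Ay hz hact hp (leqnn _)) => v Rv.
have [w Rw hw] := act_poly hR hs hd hx Ay sS hact hp Rv.
case: (eqVneq w 0) => [w0|w0]; first by rewrite -w0.
by case: nex'; exists v, w.
Qed.

End Faithful.

(** * Linear maps evaluated on formal sums of tensors *)

Section LinearMaps.
Variables (k : fieldType) (H : algType k).

Definition lin (f : H -> H) : Prop := forall c a b, f (c *: a + b) = c *: f a + f b.
Definition linear_form_on (B : H -> Prop) (g : H -> k) : Prop :=
  forall c a b, B a -> B b -> g (c *: a + b) = c * g a + g b.
Definition linear_form (g : H -> k) : Prop := forall c a b, g (c *: a + b) = c * g a + g b.
(** Viewing a form as a map into [H] lets one convolution product serve for both forms and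
    endomorphisms. *)
Definition emb (g : H -> k) (a : H) : H := g a *: 1.

Section Lin.
Variables (f : H -> H) (hf : lin f).
Lemma linD a b : f (a + b) = f a + f b. Proof. by have := hf 1 a b; rewrite !scale1r. Qed.
Lemma lin0 : f 0 = 0. Proof. by have := linD 0 0; rewrite addr0 -[LHS]addr0 => /addrI. Qed.
Lemma linZ c a : f (c *: a) = c *: f a. Proof. by have := hf c a 0; rewrite lin0 !addr0. Qed.
Lemma lin_sum (I : Type) (s : seq I) (F : I -> H) :
  f (\sum_(i <- s) F i) = \sum_(i <- s) f (F i).
Proof. by apply: (big_morph f linD lin0). Qed.
End Lin.

Section Form.
Variables (g : H -> k) (hg : linear_form g).
Lemma lformD a b : g (a + b) = g a + g b. Proof. by have := hg 1 a b; rewrite scale1r mul1r. Qed.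
Lemma lform0 : g 0 = 0. Proof. by have := lformD 0 0; rewrite addr0 -[LHS]addr0 => /addrI. Qed.
Lemma lformZ c a : g (c *: a) = c * g a. Proof. by have := hg c a 0; rewrite lform0 !addr0. Qed.
Lemma lformN a : g (- a) = - g a. Proof. by rewrite -scaleN1r lformZ mulN1r. Qed.
Lemma lformB a b : g (a - b) = g a - g b. Proof. by rewrite lformD lformN. Qed.
Lemma lform_sum (I : Type) (s : seq I) (F : I -> H) :
  g (\sum_(i <- s) F i) = \sum_(i <- s) g (F i).
Proof. by apply: (big_morph g lformD lform0). Qed.
Lemma lin_emb : lin (emb g).
Proof. by move=> c a b; rewrite /emb hg scalerDl scalerA. Qed.
End Form.

Lemma lin_id : lin id. Proof. by []. Qed.
Lemma lin_mulr (f : H -> H) a : lin f -> lin (fun b => f (b * a)).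
Proof. by move=> hf c b b'; rewrite mulrDl -scalerAl hf. Qed.
Lemma lin_mull (f : H -> H) a : lin f -> lin (fun b => f (a * b)).
Proof. by move=> hf c b b'; rewrite mulrDr -scalerAr hf. Qed.

Lemma eq_big_In (V : nmodType) (T : Type) (s : seq T) (F G : T -> V) :
  (forall u, List.In u s -> F u = G u) -> \sum_(u <- s) F u = \sum_(u <- s) G u.
Proof.
elim: s => [|u s IH] h; first by rewrite !big_nil.
by rewrite !big_cons h ?IH //=; [move=> v hv; apply: h; right | left].
Qed.

Lemma sub_big_In B (T : Type) (s : seq T) (F : T -> H) : is_subalg B ->
  (forall u, List.In u s -> B (F u)) -> B (\sum_(u <- s) F u).
Proof.
move=> hB; elim: s => [|u s IH] h; first by rewrite big_nil; apply: sub0.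
by rewrite big_cons; apply: (subD hB); [apply: h; left | apply: IH => v hv; apply: h; right].
Qed.

(** The universal property of the tensor power: the hypotheses on [phi] match the generating
    relations of [teq], and the commutation of summands is absorbed by addition in [H]. *)
Lemma teq_eval n (phi : ('I_n -> H) -> H) :
  (forall t i, t i = 0 -> phi t = 0) ->
  (forall t i a b, t i = a + b -> phi t = phi (upd t i a) + phi (upd t i b)) ->
  (forall t i j c, phi (upd t i (c *: t i)) = phi (upd t j (c *: t j))) ->
  forall s t, teq s t -> \sum_(u <- s) phi u = \sum_(u <- t) phi u.
Proof.
move=> h0 hD hZ s t; elim=> {s t} //; last by move=> s t u _ -> _ ->.
move=> _ _ [l [r [u [v [-> -> h]]]]]; rewrite !big_cat /=; congr (_ + (_ + _)).
case: h => [w i /h0|w i a b /hD|w i j c|s1 s2].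
- by rewrite big_seq1 big_nil.
- by rewrite !big_cons !big_nil !addr0.
- by rewrite !big_seq1 (hZ w i j c).
- by rewrite !big_cat /= addrC.
Qed.

Lemma teq_prod2 f g : lin f -> lin g -> forall s t : seq ('I_2 -> H), teq s t ->
  \sum_(u <- s) f (u i20) * g (u i21) = \sum_(u <- t) f (u i20) * g (u i21).
Proof.
move=> hf hg; have i2P (i : 'I_2) : i = i20 \/ i = i21.
  by case: i => [[|[|]]] // hi; [left | right]; apply: val_inj.
apply: teq_eval.
- by move=> t i; case: (i2P i) => -> ->; rewrite lin0 ?mulr0 ?mul0r.
- by move=> t i a b; rewrite /upd; case: (i2P i) => -> /= ->; rewrite linD // ?mulrDl ?mulrDr.
- move=> t i j c; rewrite /upd.
  by case: (i2P i) => ->; case: (i2P j) => ->; rewrite /= ?(linZ hf) ?(linZ hg) -!(scalerAl, scalerAr).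
Qed.

Definition i30 : 'I_3 := ord0.
Definition i31 : 'I_3 := inord 1.
Definition i32 : 'I_3 := ord_max.

Lemma teq_prod3 f g h : lin f -> lin g -> lin h -> forall s t : seq ('I_3 -> H), teq s t ->
  \sum_(u <- s) f (u i30) * g (u i31) * h (u i32) =
  \sum_(u <- t) f (u i30) * g (u i31) * h (u i32).
Proof.
move=> hf hg hh.
have v1 : val i31 = 1%N by rewrite /= inordK.
have i3P (i : 'I_3) : [\/ i = i30, i = i31 | i = i32].
  case: i => [[|[|[|]]]] // hi; [apply: Or31 | apply: Or32 | apply: Or33];
  by apply: val_inj => //; rewrite v1.
have n01 : (i30 == i31) = false by rewrite -val_eqE v1.
have n10 : (i31 == i30) = false by rewrite -val_eqE v1.
have n21 : (i32 == i31) = false by rewrite -val_eqE v1.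
have n12 : (i31 == i32) = false by rewrite -val_eqE v1.
have n02 : (i30 == i32) = false by [].
have n20 : (i32 == i30) = false by [].
have E := (n01, n10, n21, n12, n02, n20, eqxx).
apply: teq_eval.
- by move=> t i; case: (i3P i) => -> ->; rewrite lin0 ?mulr0 ?mul0r.
- move=> t i a b; rewrite /upd; case: (i3P i) => ->; rewrite !E => ->.
  + by rewrite linD // !mulrDl.
  + by rewrite linD // mulrDr mulrDl.
  + by rewrite linD // mulrDr.
- move=> t i j c; rewrite /upd.
  by case: (i3P i) => ->; case: (i3P j) => ->; rewrite !E ?(linZ hf) ?(linZ hg) ?(linZ hh) -!(scalerAl, scalerAr).
Qed.

End LinearMaps.

(** * Convolution, characters and winding endomorphisms *)

Section Hopf.
Variables (k : fieldType) (H : algType k) (Delta : H -> seq ('I_2 -> H)) (eps : H -> k) (S : H -> H).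
Hypothesis hH : is_hopf Delta eps S.

Definition conv (f g : H -> H) (a : H) : H := \sum_(u <- Delta a) f (u i20) * g (u i21).

(** Linearity is asked on all of [H] because the chosen representative [Delta a] may involve tensor
    factors outside [B], even for [a] in [B]; multiplicativity matters only on [B]. *)
Definition character (B : H -> Prop) (g : H -> k) : Prop :=
  [/\ linear_form g, g 1 = 1 & forall a b, B a -> B b -> g (a * b) = g a * g b].

Lemma conv_teq f g a s : lin f -> lin g -> teq (Delta a) s ->
  conv f g a = \sum_(u <- s) f (u i20) * g (u i21).
Proof. by move=> hf hg; apply: teq_prod2. Qed.

Lemma lin_conv f g : lin f -> lin g -> lin (conv f g).
Proof.
case: hH => hD hZ _ _ _ hf hg c a b.
rewrite (conv_teq hf hg (hD _ _)) big_cat /= -/(conv f g (c *: a)) -/(conv f g b).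
congr (_ + _); rewrite (conv_teq hf hg (hZ _ _)) big_map scaler_sumr.
by apply: eq_bigr => u _; rewrite /upd /= linZ // scalerAl.
Qed.

Lemma convA f g h a : lin f -> lin g -> lin h ->
  conv (conv f g) h a = conv f (conv g h) a.
Proof.
case: hH => _ _ _ _ [cA _ _ _ _] hf hg hh.
have v1 : val i31 = 1%N by rewrite /= inordK.
have := teq_prod3 hf hg hh (cA a); rewrite !big_flatten /= !big_map => e.
transitivity (\sum_(u <- Delta a) \sum_(v <- Delta (u i20)) f (v i20) * g (v i21) * h (u i21)).
  by apply: eq_bigr => u _; rewrite mulr_suml.
transitivity (\sum_(u <- Delta a) \sum_(v <- Delta (u i21)) f (u i20) * g (v i20) * h (v i21)).
  move: e; under eq_bigr do rewrite big_map; under [in RHS]eq_bigr do rewrite big_map.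
  by rewrite /pure3 v1.
by apply: eq_bigr => u _; rewrite mulr_sumr; apply: eq_bigr => v _; rewrite mulrA.
Qed.

Lemma eps_form : linear_form eps.
Proof. by case: hH => _ _ _ _ [_ [hD hZ _ _] _ _ _] c a b; rewrite hD hZ. Qed.

Lemma eps_character B : character B eps.
Proof. by case: (hH) => _ _ _ _ [_ [_ _ hM h1] _ _ _]; split=> //; apply: eps_form. Qed.

Lemma conv_epsl f a : lin f -> conv (emb eps) f a = f a.
Proof.
move=> hf; case: hH => _ _ _ _ [_ _ hc _ _].
rewrite -[in RHS](hc a).1 lin_sum //; apply: eq_bigr => u _.
by rewrite /emb (linZ hf) -scalerAl mul1r.
Qed.

Lemma conv_epsr f a : lin f -> conv f (emb eps) a = f a.
Proof.
move=> hf; case: hH => _ _ _ _ [_ _ hc _ _].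
rewrite -[in RHS](hc a).2 lin_sum //; apply: eq_bigr => u _.
by rewrite /emb (linZ hf) -scalerAr mulr1.
Qed.

Lemma antipode_lin : lin S.
Proof. by case: hH => _ _ _ _ [_ _ _ [hD hZ] _] c a b; rewrite hD hZ. Qed.

Lemma form_antipode g : linear_form g -> linear_form (g \o S).
Proof. by move=> hg c a b /=; rewrite antipode_lin hg. Qed.

Lemma form_conv g chi a : linear_form g -> linear_form chi ->
  conv (emb g) (emb chi) a = g (conv id (emb chi) a) *: 1 /\
  conv (emb g) (emb chi) a = chi (conv (emb g) id a) *: 1.
Proof.
move=> hg hchi; rewrite !lform_sum // !scaler_suml; split; apply: eq_bigr => u _.
  by rewrite /emb -!scalerAr mulr1 mulr1 lformZ // scalerA.
by rewrite /emb -!scalerAl mul1r mul1r lformZ // scalerA mulrC.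
Qed.

(** Both sides are the value at [a] of the convolution product of [g] and [chi]; [eps] strips the
    unit from [form_conv]. *)
Lemma form_conv_swap g chi a : linear_form g -> linear_form chi ->
  g (conv id (emb chi) a) = chi (conv (emb g) id a).
Proof.
move=> hg hchi; have [-> e] := form_conv a hg hchi.
have := congr1 eps e; rewrite !lformZ; try exact: eps_form.
by case: (eps_character (fun _ => True)) => _ -> _; rewrite !mulr1.
Qed.

Section Subalgebra.
Variable B : H -> Prop.
Hypothesis hB : is_hopf_subalg Delta S B.

Lemma hopf_subalg : is_subalg B. Proof. by case: hB => *; split. Qed.

Lemma hopf_subS a : B a -> B (S a). Proof. by case: hB => _ _ _ _ [h _]; apply: h. Qed.

Lemma hopf_subDelta a : B a -> exists2 s, teq (Delta a) s &
  forall u, List.In u s -> B (u i20) /\ B (u i21).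
Proof. by case: hB => _ _ _ _ [_ h] /h[s [hs hu]]; exists s. Qed.

(** A Hopf subalgebra supplies a representative of the coproduct of [a] with all factors in [B], and
    convolution does not depend on the representative. *)
Lemma conv_local f f' g g' a : lin f -> lin f' -> lin g -> lin g' ->
  (forall b, B b -> f b = f' b) -> (forall b, B b -> g b = g' b) -> B a ->
  conv f g a = conv f' g' a.
Proof.
move=> hf hf' hg hg' ef eg /hopf_subDelta[s hs hu].
rewrite (conv_teq hf hg hs) (conv_teq hf' hg' hs); apply: eq_big_In => u /hu[u0 u1].
by rewrite ef ?eg.
Qed.

Lemma conv_sub f g a : lin f -> lin g ->
  (forall b, B b -> B (f b)) -> (forall b, B b -> B (g b)) -> B a -> B (conv f g a).
Proof.
move=> hf hg sf sg /hopf_subDelta[s hs hu]; rewrite (conv_teq hf hg hs).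
apply: sub_big_In; first exact: hopf_subalg.
by move=> u /hu[u0 u1]; apply: (subM hopf_subalg); [apply: sf | apply: sg].
Qed.

Lemma sub_emb g a : B (emb g a).
Proof. by apply: (subZ hopf_subalg); apply: (sub1 hopf_subalg). Qed.

Definition winding (g : H -> k) : H -> H := conv (emb g) id.

Lemma lin_winding g : linear_form g -> lin (winding g).
Proof. by move=> hg; apply: lin_conv; [apply: lin_emb | apply: lin_id]. Qed.

Lemma winding_sub g a : linear_form g -> B a -> B (winding g a).
Proof.
by move=> hg; apply: conv_sub => //; [apply: lin_emb | move=> *; apply: sub_emb].
Qed.

Lemma windingM g a b : character B g -> B a -> B b -> winding g (a * b) = winding g a * winding g b.
Proof.
case: (hH) => _ _ hM _ _ [hg _ gM] Ba Bb.
have le := lin_emb hg; have li := @lin_id k H.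
have [sa ha ua] := hopf_subDelta Ba; have [sb hb ub] := hopf_subDelta Bb.
rewrite /winding (conv_teq le li (hM a b)) /tmul2 big_allpairs_dep /=.
(* The two coproducts are replaced one after the other by representatives inside [B], where [g] is
   multiplicative. *)
transitivity (\sum_(u <- Delta a) \sum_(v <- sb) emb g (u i20 * v i20) * (u i21 * v i21)).
  by apply: eq_bigr => u _; apply: (teq_prod2 (lin_mull _ le) (lin_mull _ li) hb).
rewrite exchange_big /= (conv_teq le li ha) (conv_teq le li hb) mulr_sumr.
apply: eq_big_In => v /ub[v0 v1]; rewrite mulr_suml.
rewrite (teq_prod2 (lin_mulr _ le) (lin_mulr _ li) ha); apply: eq_big_In => u /ua[u0 u1].
by rewrite /emb gM // -!scalerAl !mul1r -scalerAr scalerA.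
Qed.

(** Applying [g] to the antipode axiom shows that [g \o S] is the convolution inverse of [g]. *)
Lemma conv_character_antipode g a : character B g -> B a ->
  conv (emb (g \o S)) (emb g) a = emb eps a /\ conv (emb g) (emb (g \o S)) a = emb eps a.
Proof.
case=> hg g1 gM Ba; have [s hs hu] := hopf_subDelta Ba.
case: (hH) => _ _ _ _ [_ _ _ _ hS]; have lS := antipode_lin; have li := @lin_id k H.
have lg := lin_emb hg; have lgS := lin_emb (form_antipode hg).
have e1 := hS a; rewrite -/(conv S id a) -/(conv id S a) (conv_teq lS li hs) (conv_teq li lS hs) in e1.
rewrite (conv_teq lgS lg hs) (conv_teq lg lgS hs) {3 6}/emb.
have -> : eps a *: 1 = g (eps a *: 1) *: 1 :> H by rewrite lformZ // g1 mulr1.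
split; [rewrite -{1}e1.1 | rewrite -{1}e1.2]; rewrite lform_sum // scaler_suml;
  apply: eq_big_In => u /hu[u0 u1]; rewrite gM //; try exact: hopf_subS;
  by rewrite /emb /= -scalerAl mul1r scalerA.
Qed.

(** Windings compose by convolution of their forms, and [g] convolved with [g \o S] is [eps], whose
    winding is the identity. *)
Lemma windingK g a : character B g -> B a -> winding (g \o S) (winding g a) = a.
Proof.
move=> cg Ba; have [hg _ _] := cg.
have li := @lin_id k H; have lg := lin_emb hg; have lgS := lin_emb (form_antipode hg).
have lw := lin_winding (form_antipode hg).
have -> : winding (g \o S) (winding g a) = conv (emb g) (winding (g \o S)) a.
  rewrite {2}/winding /conv lin_sum //; apply: eq_bigr => u _.
  by rewrite /emb -!scalerAl !mul1r linZ.
rewrite -convA // (@conv_local _ (emb eps) _ id) ?conv_epsl //.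
- exact: lin_conv.
- exact/lin_emb/eps_form.
- by move=> b Bb; have [] := conv_character_antipode cg Bb.
Qed.

Lemma eps_winding g a : linear_form g -> eps (winding g a) = g a.
Proof.
move=> hg; have [_ e] := form_conv a hg eps_form.
rewrite conv_epsr in e; last exact: lin_emb.
by have := congr1 eps e; rewrite !lformZ; try exact: eps_form; case: (eps_character (fun _ => True)) => _ -> _; rewrite !mulr1.
Qed.

(* A right translation with a fixed point is trivial. *)
Lemma fixed_character p chi : character B p -> linear_form chi ->
  (forall a, B a -> p (conv id (emb chi) a) = p a) -> forall a, B a -> chi a = eps a.
Proof.
move=> cp hchi fix_p a Ba; have [hp _ _] := cp.
have lp := lin_emb hp; have lpS := lin_emb (form_antipode hp); have lc := lin_emb hchi.
have le := lin_emb eps_form.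
have : emb chi a = emb eps a.
  rewrite -[LHS]conv_epsl //.
  (* Group computation: [chi] is [p^-1 p chi], and [p chi = p], so it equals [p^-1 p = eps], where
     [p^-1] is [p \o S]. *)
  transitivity (conv (conv (emb (p \o S)) (emb p)) (emb chi) a).
    apply: conv_local => //; first exact: lin_conv.
    by move=> b Bb; have [-> _] := conv_character_antipode cp Bb.
  rewrite convA //; have [<- _] := conv_character_antipode cp Ba.
  apply: conv_local => //; first exact: lin_conv.
  by move=> b Bb; have [-> _] := form_conv b hp hchi; rewrite fix_p.
move=> /(congr1 eps); rewrite !lformZ; try exact: eps_form.
by case: (eps_character B) => _ -> _; rewrite !mulr1.
Qed.

End Subalgebra.
End Hopf.

(** * The chain of Ore extensions and its generators *)

Section Chain.
Variables (k : closedFieldType) (char0 : [pchar k] =i pred0) (H : algType k)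
  (Delta : H -> seq ('I_2 -> H)) (eps : H -> k) (S : H -> H)
  (hH : is_hopf Delta eps S) (n : nat) (x : 'I_n -> H) (sigma delta : 'I_n -> H -> H).
Local Notation R := (gen_subalg x).
Hypotheses (hgen : forall h, R n h)
  (hhopf : forall i, (i <= n)%N -> is_hopf_subalg Delta S (R i))
  (hore : forall j : 'I_n,
          [/\ is_alg_aut_on (R j) (sigma j), is_sigma_der_on (R j) (sigma j) (delta j),
              (forall r, R j r -> x j * r - sigma j r * x j = delta j r) &
              (forall (m : nat) (r : 'I_m -> H), (forall l, R j (r l)) ->
                 \sum_(l < m) r l * x j ^+ l = 0 -> forall l, r l = 0)]).

Let hs (j : 'I_n) : is_alg_aut_on (R j) (sigma j). Proof. by case: (hore j). Qed.
Let hd (j : 'I_n) : is_sigma_der_on (R j) (sigma j) (delta j). Proof. by case: (hore j). Qed.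
Let hx (j : 'I_n) : forall r, R j r -> x j * r - sigma j r * x j = delta j r.
Proof. by case: (hore j). Qed.

Let hR i : (i <= n)%N -> is_subalg (R i).
Proof. by move=> /hhopf; apply: hopf_subalg. Qed.
Let hRj (j : 'I_n) : is_subalg (R j).
Proof. exact/hR/ltnW. Qed.
Let hRj1 (j : 'I_n) : is_subalg (R j.+1).
Proof. exact/hR/ltn_ord. Qed.

Lemma chain_free (j : 'I_n) : left_free (R j) (x j).
Proof.
move=> p hp p0; have [_ _ _ free] := hore j.
have h (l : 'I_(size p)) : p`_l = 0.
  by apply: (free _ (fun l : 'I_(size p) => p`_l)) => //; rewrite -horner_coef.
apply/polyP => i; rewrite coef0; case: (ltnP i (size p)) => [ip|]; last exact: nth_default.
exact: (h (Ordinal ip)).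
Qed.

Lemma gen_var (i : nat) (j : 'I_n) : (j < i)%N -> R i (x j).
Proof.
move=> ji; exists [:: (1, [:: j])]; split.
  by move=> p [<-|[]] l [<-|[]].
by rewrite !big_seq1 scale1r.
Qed.

(** Serves as the induction principle for [R i]: a property that cuts out a subalgebra is checked on
    the generators only. *)
Lemma gen_min (i : nat) (B : H -> Prop) : is_subalg B ->
  (forall j : 'I_n, (j < i)%N -> B (x j)) -> forall h, R i h -> B h.
Proof.
move=> hB hx' _ [s [hs' ->]]; apply: (sub_big_In hB) => p /hs' hp; apply: subZ => //.
elim: p.2 hp => [|j w IH] hp; first by rewrite big_nil; apply: sub1.
rewrite big_cons; apply: (subM hB); first by apply/hx'/hp; left.
by apply: IH => l hl; apply: hp; right.
Qed.

Lemma gen_mono i j h : (i <= j <= n)%N -> R i h -> R j h.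
Proof.
move=> /andP[ij jn]; apply: gen_min; first exact: hR.
by move=> l li; apply/gen_var/(leq_trans li).
Qed.

Lemma gen0 h : R 0 h -> exists c : k, h = c *: 1.
Proof.
move: h; apply: gen_min => //; split.
- by exists 1; rewrite scale1r.
- by move=> _ _ [a ->] [b ->]; exists (a + b); rewrite scalerDl.
- by move=> c _ [a ->]; exists (c * a); rewrite scalerA.
- by move=> _ _ [a ->] [b ->]; exists (a * b); rewrite -scalerAl mul1r scalerA.
Qed.

Lemma genS (j : 'I_n) h : R j.+1 h <-> ore_span (R j) (x j) h.
Proof.
split.
  move: h; apply: gen_min; first exact: (span_subalg (hRj j) (hs j) (hd j) (@hx j)).
  move=> l; rewrite ltnS leq_eqVlt => /orP[/eqP/val_inj ->|lj]; first exact: span_var.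
  by apply/span_sub/gen_var.
case=> p hp ->; rewrite horner_coef; apply: (sub_sum (hRj1 j)) => i _.
apply: (subM (hRj1 j)); last by apply/(subX (hRj1 j))/gen_var.
by apply: (gen_mono (i := j)); rewrite ?leqnSn ?ltn_ord.
Qed.

Lemma span_uniq (j : 'I_n) p q : poly_in (R j) p -> poly_in (R j) q ->
  p.[x j] = q.[x j] -> p = q.
Proof.
move=> hp hq e; apply/eqP; rewrite -subr_eq0; apply/eqP.
apply: (@chain_free j); first by apply: poly_inB.
by rewrite hornerD hornerN e subrr.
Qed.

(** * Extending linear forms and characters along the chain *)

Lemma form_on0 i g : (i <= n)%N -> linear_form_on (R i) g -> g 0 = 0.
Proof.
move=> /hR hRi hg; have := hg 1 0 0 (sub0 hRi) (sub0 hRi).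
by rewrite scaler0 addr0 mul1r -[LHS]addr0 => /addrI.
Qed.

Lemma map_polyC_form (g : H -> k) c : g 0 = 0 -> map_poly g c%:P = (g c)%:P.
Proof. by move=> g0; apply/polyP => i; rewrite coef_map_id0 // !coefC; case: ifP. Qed.

(** Coefficients over [R j] are unique, so applying [g] to them and evaluating at [t] is well
    defined. The result is only linear, whatever [t]. *)
Lemma eval_step (j : 'I_n) g t : linear_form_on (R j) g -> exists g', linear_form_on (R j.+1) g' /\
  forall p, poly_in (R j) p -> g' p.[x j] = (map_poly g p).[t].
Proof.
(* [pol] picks the coefficient polynomial of an element by choice; [polE] shows that there is just
   one. *)
move=> hg; pose pol h := epsilon (inhabits (0 : {poly H})) (fun p => poly_in (R j) p /\ h = p.[x j]).
have polE p : poly_in (R j) p -> pol p.[x j] = p.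
  move=> hp; have [hq e] : poly_in (R j) (pol p.[x j]) /\ p.[x j] = (pol p.[x j]).[x j].
    by apply: (epsilon_spec _ (fun q => poly_in (R j) q /\ p.[x j] = q.[x j])); exists p.
  exact: span_uniq.
have g0 := form_on0 (ltnW (ltn_ord j)) hg.
exists (fun h => (map_poly g (pol h)).[t]); split; last by move=> p /polE ->.
move=> c _ _ /genS[p hp ->] /genS[q hq ->].
have hc : poly_in (R j) ((c *: 1)%:P * p) by apply: poly_inZ.
have -> : c *: p.[x j] + q.[x j] = ((c *: 1)%:P * p + q).[x j].
  by rewrite hornerD horner_polyCM -scalerAl mul1r.
rewrite !polE //; last exact: poly_inD.
rewrite -hornerZ -hornerD; congr (_.[_]); apply/polyP => i.
rewrite coefD coefZ !coef_map_id0 // coefD coefCM -scalerAl mul1r hg //.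
Qed.

(** Climbs the chain with [eval_step] at [t = 0]; this provides the linearity on all of [H] that
    convolution needs. *)
Lemma form_extend i g : (i <= n)%N -> linear_form_on (R i) g ->
  exists2 g', linear_form g' & forall r, R i r -> g' r = g r.
Proof.
have [m] := ubnP (n - i); elim: m i g => // m IH i g im; rewrite leq_eqVlt => /orP[/eqP e|lt] hg.
  by exists g => // c a b; apply: hg; rewrite e.
have [g1 [h1 e1]] := @eval_step (Ordinal lt) g 0 hg.
have [|g2 h2 e2] := IH i.+1 g1 _ lt h1.
  by rewrite subnS prednK ?subn_gt0.
exists g2 => // r Ri; rewrite e2; last by apply: gen_mono Ri; rewrite leqnSn.
have := e1 r%:P; rewrite hornerC => ->; last exact: (poly_inC (hR (ltnW lt))).
by rewrite map_polyC_form ?hornerC // (form_on0 (ltnW lt) hg).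
Qed.

(** The condition on [t] is the image of [x r = sigma r x + delta r] under a character sending [x]
    to [t]; it is what makes the coefficientwise extension multiplicative. *)
Lemma character_step (j : 'I_n) g t : character (R j) g ->
  (forall r, R j r -> g (sigma j r) * t + g (delta j r) = g r * t) ->
  exists g', [/\ character (R j.+1) g', (forall r, R j r -> g' r = g r) &
     forall p, poly_in (R j) p -> g' p.[x j] = (map_poly g p).[t]].
Proof.
move=> [hg g1 gM] ht.
have hg' : linear_form_on (R j) g by move=> c a b _ _; apply: hg.
have [f0 [h0 e0]] := eval_step t hg'; have [g' lg' e'] := form_extend (ltn_ord j) h0.
have g0 := lform0 hg.
have eg p : poly_in (R j) p -> g' p.[x j] = (map_poly g p).[t].
  by move=> hp; rewrite e' ?e0 //; apply/genS; exists p.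
have er r : R j r -> g' r = g r.
  move=> Rr; have := eg r%:P; rewrite hornerC map_polyC_form // hornerC; apply.
  exact: poly_inC.
have eX p : poly_in (R j) p -> g' (p.[x j] * x j) = g' p.[x j] * t.
  move=> hp; rewrite -hornerMX !eg //; last exact: poly_inMX.
  have -> : map_poly g (p * 'X) = map_poly g p * 'X.
    by apply/polyP => i; rewrite coef_map_id0 // !coefMX; case: ifP; rewrite ?coef_map_id0.
  by rewrite hornerMX.
have eC r p : R j r -> poly_in (R j) p -> g' (r * p.[x j]) = g r * g' p.[x j].
  move=> Rr hp; rewrite -horner_polyCM !eg //; last exact: poly_inCM.
  rewrite -hornerZ; congr (_.[_]); apply/polyP => i.
  by rewrite coefZ !coef_map_id0 // coefCM gM.
(* Left multiplication by the new variable, by induction on the degree of [b]; this is where [ht]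
   enters. *)
have eV b : R j.+1 b -> g' (x j * b) = t * g' b.
  move=> /genS[p hp ->]; have [m sp] := ubnP (size p); elim: m p hp sp => // m IH p hp sp.
  have [->|p0] := eqVneq p 0; first by rewrite horner0 mulr0 (lform0 lg') mulr0.
  have hq := poly_in_drop 1 hp.
  have sq : (size (drop_poly 1 p) < m)%N by rewrite size_drop_poly subn1 prednK ?size_poly_gt0.
  have Rp := hp 0%N.
  rewrite (poly_dropX p) hornerMXaddC mulrDr mulrA (skewE (@hx j) Rp) !(lformD lg').
  have [_ _ _ aux] := span_subalg (hRj j) (hs j) (hd j) (@hx j).
  have [q hq' eq] := aux _ _ (span_var (hRj j) (x j)) (ex_intro2 _ _ _ hq erefl).
  rewrite eq (eX _ hq') -eq IH // (eX _ hq).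
  have := eX (sigma j p`_0)%:P; rewrite hornerC => ->; last by apply: poly_inC => //; apply: (autS (hs j)).
  rewrite (er _ (autS (hs j) Rp)) (er _ (derS (hd j) Rp)) (er _ Rp) ht //.
  by rewrite mulrDr !mulrA [t * g _]mulrC.
exists g'; split=> //; split=> //; first by rewrite er //; apply: sub1.
(* The left factors for which [g'] is multiplicative form a subalgebra, so it remains to test the
   generators. *)
have hmul : is_subalg (fun a => R j.+1 a /\ forall b, R j.+1 b -> g' (a * b) = g' a * g' b).
  split.
  - split; first exact: sub1 (hRj1 j).
    by move=> b _; rewrite mul1r (er _ (sub1 (hRj j))) g1 mul1r.
  - move=> a a' [Ra ha] [Ra' ha']; split; first exact: (subD (hRj1 j)).
    by move=> b Rb; rewrite mulrDl !(lformD lg') ha // ha' // mulrDl.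
  - move=> c a [Ra ha]; split; first exact: (subZ (hRj1 j)).
    by move=> b Rb; rewrite -scalerAl !(lformZ lg') ha // mulrA.
  - move=> a a' [Ra ha] [Ra' ha']; split; first exact: (subM (hRj1 j)).
    move=> b Rb; rewrite -mulrA ha ?ha' ?ha // ?mulrA //.
    exact: (subM (hRj1 j)).
move=> a b Ra Rb; have [_] : R j.+1 a /\ forall b, R j.+1 b -> g' (a * b) = g' a * g' b.
  move: a Ra; apply: gen_min => // l; rewrite ltnS leq_eqVlt => /orP[/eqP/val_inj ->|lj].
    split; first exact: gen_var.
    move=> c Rc; rewrite eV //; congr (_ * _).
    have R1 := sub1 (hRj j).
    by have := eX 1 (poly_inC (hRj j) R1); rewrite hornerC mul1r (er _ R1) g1 mul1r.
  split; first by apply: gen_var; apply: leqW.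
  have Rl : R j (x l) by apply: gen_var.
  by move=> c /genS[p hp ->]; rewrite (eC _ _ Rl hp) (er _ Rl).
exact.
Qed.

Definition commutative_on (B : H -> Prop) : Prop := forall a b, B a -> B b -> a * b = b * a.

Lemma commutative_mono i j : (i <= j <= n)%N -> commutative_on (R j) -> commutative_on (R i).
Proof. by move=> ij h a b Ra Rb; apply: h; apply: (gen_mono ij). Qed.

Lemma commutative_trivial (j : 'I_n) : commutative_on (R j.+1) ->
  forall r, R j r -> sigma j r = r /\ delta j r = 0.
Proof.
move=> cm r Rr; have Rsr := autS (hs j) Rr; have Rdr := derS (hd j) Rr.
pose p := (r - sigma j r)%:P * 'X + (- delta j r)%:P.
have p0 : p = 0.
  apply: (@chain_free j).
    apply: (poly_inD (hRj j)); last exact/(poly_inC (hRj j))/(subN (hRj j)).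
    apply: (poly_inMX (hRj j)); apply: (poly_inC (hRj j)); exact: (subB (hRj j)).
  rewrite hornerMXaddC hornerC -(hx Rr) opprB mulrBl addrA subrK.
  rewrite (cm r (x j)) ?subrr //; last exact: gen_var.
  by apply: gen_mono Rr; rewrite leqnSn ltn_ord.
split.
  have := congr1 (fun q : {poly H} => q`_1) p0.
  by rewrite coefD coefCM coefX coefC /= coef0 mulr1 addr0 => /eqP; rewrite subr_eq0 => /eqP.
have := congr1 (fun q : {poly H} => q`_0) p0.
by rewrite coefD coefCM coefX coefC /= coef0 mulr0 add0r => /eqP; rewrite oppr_eq0 => /eqP.
Qed.

(** Climbing the chain, a character nonzero on both leading coefficients keeps both polynomials
    nonzero. By commutativity it extends with any value [t] at the new variable, and some [t] avoids
    all their roots. *)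
Lemma separation i a b : (i <= n)%N -> commutative_on (R i) -> R i a -> R i b ->
  a != 0 -> b != 0 -> exists g, [/\ character (R i) g, g a != 0 & g b != 0].
Proof.
elim: i a b => [|i IH] a b.
  move=> _ _ /gen0[c ->] /gen0[d ->] a0 b0; exists eps.
  have [he e1 eM] := eps_character hH (R 0); rewrite !lformZ // e1 !mulr1.
  split; first exact: (eps_character hH).
  - by apply: contra_neq a0 => ->; rewrite scale0r.
  - by apply: contra_neq b0 => ->; rewrite scale0r.
move=> lt cm; pose j := Ordinal lt.
move=> /(genS j)[p hp ->] /(genS j)[q hq ->] pa qb.
have p0 : p != 0 by apply: contra_neq pa => ->; rewrite horner0.
have q0 : q != 0 by apply: contra_neq qb => ->; rewrite horner0.
have cmi : commutative_on (R i) by apply: commutative_mono cm; rewrite leqnSn.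
have [||g [cg ga gb]] := IH (lead_coef p) (lead_coef q) (ltnW lt) cmi (hp _) (hq _).
- by rewrite lead_coef_eq0.
- by rewrite lead_coef_eq0.
have [hg g1 gM] := cg; have g0 := lform0 hg.
have nz (r : {poly H}) : g (lead_coef r) != 0 -> map_poly g r != 0.
  apply: contra_neq => r0; have := coef_map_id0 r (size r).-1 g0.
  by rewrite r0 coef0 lead_coefE.
have /closed_nonrootP[t] : map_poly g p * map_poly g q != 0 by rewrite mulf_neq0 ?nz.
rewrite rootE hornerM mulf_eq0 negb_or => /andP[tp tq].
have [|g' [cg' _ eg]] := character_step (j := j) (t := t) cg.
  by move=> r Rr; have [-> ->] := commutative_trivial (j := j) cm Rr; rewrite g0 addr0.
by exists g'; rewrite !eg.
Qed.

(** A character nonzero on both factors is nonzero on the product. *)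
Lemma chain_domain i : (i <= n)%N -> commutative_on (R i) -> comm_domain (R i).
Proof.
move=> le cm; split=> // a b Ra Rb a0 b0.
have [g [[hg _ gM] ga gb]] := separation le cm Ra Rb a0 b0.
by apply: contra_neq (mulf_neq0 ga gb) => e; rewrite -gM // e lform0.
Qed.

(** Apply [delta j] to [a * b = b * a]. Where [sigma j b - b] is invertible, [delta j] is thus
    determined by [sigma j] and [delta j b]. *)
Lemma sigma_der_symm (j : 'I_n) a b : commutative_on (R j) -> R j a -> R j b ->
  (sigma j b - b) * delta j a = (sigma j a - a) * delta j b.
Proof.
move=> cm Ra Rb; have := congr1 (delta j) (cm a b Ra Rb); rewrite !(derM (hd j)) //.
rewrite (cm _ _ (derS (hd j) Ra) Rb) (cm _ _ (derS (hd j) Rb) Ra) => e.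
by apply/eqP; rewrite !mulrBl subr_eq addrAC -subr_eq opprK -e; apply/eqP.
Qed.

(** * An automorphism of finite order is a winding, and then trivial *)

Section Step.
Variable j : 'I_n.
Hypotheses (cm : commutative_on (R j)) (q : nat) (q0 : (0 < q)%N)
  (hq : forall a, R j a -> iter q (sigma j) a = a).
Let dom := chain_domain (ltnW (ltn_ord j)) cm.
Let hopfj : is_hopf_subalg Delta S (R j) := hhopf (ltnW (ltn_ord j)).
Let hopfj1 : is_hopf_subalg Delta S (R j.+1) := hhopf (ltn_ord j).

Lemma iter_mod m a : R j a -> iter m (sigma j) a = iter (m %% q) (sigma j) a.
Proof.
move=> Ra; rewrite {1}(divn_eq m q) addnC iterD.
have Rm : forall c, R j c -> iter (m %/ q * q) (sigma j) c = c.
  move=> c Rc; elim: (m %/ q)%N => // d IH; rewrite mulSn iterD IH; exact: hq.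
by rewrite Rm.
Qed.

Lemma left_winding_sub chi a : linear_form chi -> R j a -> R j (conv Delta id (emb chi) a).
Proof.
move=> hc; apply: (conv_sub hopfj) => //; first exact: lin_emb.
by move=> *; apply: (sub_emb hopfj).
Qed.

(* [g] extends to [R j.+1]; the leading coefficient of the image of [x j] under
   the corresponding winding endomorphism intertwines it with [sigma j]. *)
Lemma winding_commutes b (chi : nat -> H -> k) g : R j b ->
  (forall m, linear_form (chi m)) ->
  (forall m r, R j r -> chi m r = eps (iter m (sigma j) r)) ->
  character (R j) g -> g (sigma j b - b) != 0 ->
  exists2 m, (m < q)%N & forall r, R j r -> g (conv Delta id (emb (chi m)) r) = g (sigma j r).
Proof.
move=> Rb hchi echi cg gu; have [hg g1 gM] := cg.
(* The value forced by the compatibility condition at [r = b]; [sigma_der_symm] carries the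
   condition over to every [r]. *)
pose t := - g (delta j b) / g (sigma j b - b).
have ht r : R j r -> g (sigma j r) * t + g (delta j r) = g r * t.
  move=> Rr; apply/eqP; rewrite -subr_eq0 addrAC -mulrBl -(lformB hg).
  apply/eqP/(mulfI gu); rewrite mulr0 mulrDr -gM; last 2 first.
  - by apply: (subB (hRj j)) => //; apply: (autS (hs j)).
  - exact: (derS (hd j)).
  rewrite sigma_der_symm // gM; last 2 first.
  - by apply: (subB (hRj j)) => //; apply: (autS (hs j)).
  - exact: (derS (hd j)).
  by rewrite /t mulrCA [g _ * (_ / _)]mulrC divfK // mulrN addNr.
have [g' [cg' eg' _]] := character_step cg ht; have [hg' _ _] := cg'.
pose tau := winding Delta g'.
have tR r : R j r -> R j (tau r) by apply: (winding_sub hopfj hg').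
have Rx : R j.+1 (x j) by apply: gen_var.
have R1 r : R j r -> R j.+1 r by apply: gen_mono; rewrite leqnSn ltn_ord.
have /genS[p hp ep] : R j.+1 (tau (x j)) by apply: (winding_sub hopfj1 hg').
(* Otherwise [tau (x j)] lies in [R j]; the inverse winding preserves [R j], so [x j] would lie
   there too, against freeness. *)
have sp : (1 < size p)%N.
  rewrite ltnNge; apply/negP => sp.
  have Rt : R j (tau (x j)) by rewrite ep (size1_polyC sp) hornerC; apply: hp.
  have Rxj : R j (x j).
    rewrite -(windingK hH hopfj1 cg' Rx).
    by apply: (winding_sub hopfj); first exact: (form_antipode hH).
  have : 'X = (x j)%:P :> {poly H}.
    apply: (@span_uniq j); first exact: (poly_inX (hRj j)).
      exact: poly_inC.
    by rewrite hornerX hornerC.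
  by move/(congr1 (fun q : {poly H} => size q)); rewrite size_polyX size_polyC; case: (_ != 0).
pose d := (size p).-1.
have dS : size p = d.+1 by rewrite /d prednK // ltnW.
have d0 : (0 < d)%N by rewrite -ltnS -dS.
(* Compare the coefficients of degree [d] in [tau] of [x r = sigma r x + delta r]; as [d > 0], the
   term [tau (delta j r)] does not contribute. *)
have key r : R j r -> iter d (sigma j) (tau r) = tau (sigma j r).
  move=> Rr; have Rtr := tR r Rr; have Rsr := autS (hs j) Rr; have Rdr := derS (hd j) Rr.
  have Rts := tR _ Rsr; have Rtd := tR _ Rdr.
  have lw := lin_winding hH hg'.
  have e : tau (x j * r) = tau (sigma j r * x j + delta j r) by rewrite (skewE (@hx j) Rr).
  rewrite /tau (linD lw) !(windingM hH hopfj1 cg') -/tau ?ep in e; try exact: R1; try exact: Rx.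
  have le : (size p <= d.+1)%N by rewrite dS.
  have [r1 [h1 _ c1 e1]] := skew_mulC (hRj j) (hs j) (hd j) (@hx j) hp le Rtr.
  have e2 : r1 = (tau (sigma j r))%:P * p + (tau (delta j r))%:P.
    apply: (@span_uniq j) => //.
      by apply: (poly_inD (hRj j)); [apply: (poly_inCM (hRj j)) | apply: (poly_inC (hRj j))].
    by rewrite hornerD hornerC horner_polyCM -e1.
  move: c1; rewrite e2 coefD coefCM coefC (gtn_eqF d0) addr0.
  rewrite (cm Rts (hp d)) => /esym/eqP; rewrite -subr_eq0 -mulrBr => e3.
  apply/eqP; rewrite -subr_eq0; apply: contraLR e3 => ne; apply: dom.2 => //.
  - by apply: (subB (hRj j)) => //; apply: (iter_autS (hs j)).
  - by rewrite -lead_coefE lead_coef_eq0 -size_poly_gt0 dS.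
(* Applying [eps] to [key] gives [g (sigma j r) = chi m (tau r)] for [m = d %% q], and
   [form_conv_swap] rewrites the right side. *)
exists (d %% q)%N; first by rewrite ltn_mod.
move=> r Rr; rewrite -(eg' (sigma j r)); last exact: (autS (hs j)).
rewrite -(eps_winding hH (sigma j r) hg') -/(tau _) -key // iter_mod; last exact: tR.
rewrite -echi; last exact: tR.
by rewrite -eg' ?(form_conv_swap hH) //; apply: left_winding_sub.
Qed.

(** [winding_commutes] leaves only [q] candidates, the forms [eps] composed with [iter m (sigma j)].
    If all failed, a character avoiding every failure at once would contradict it. *)
Lemma sigma_winding b : R j b -> sigma j b != b ->
  exists2 chi, linear_form chi & forall r, R j r -> sigma j r = conv Delta id (emb chi) r.
Proof.
move=> Rb sb.
have exchi m : exists chi, linear_form chi /\ forall r, R j r -> chi r = eps (iter m (sigma j) r).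
  have [|chi h1 h2] := @form_extend j (fun r => eps (iter m (sigma j) r)) (ltnW (ltn_ord j)).
    move=> c a a' Ra Ra'; rewrite (iter_autD (hs j)) ?(iter_autZ (hs j)) //; last exact: subZ.
    exact: (eps_form hH).
  by exists chi.
pose chi m := proj1_sig (constructive_indefinite_description _ (exchi m)).
have hchi m : linear_form (chi m).
  by have [] := proj2_sig (constructive_indefinite_description _ (exchi m)).
have echi m : forall r, R j r -> chi m r = eps (iter m (sigma j) r).
  by have [] := proj2_sig (constructive_indefinite_description _ (exchi m)).
apply: NNPP => nex.
have bad m : exists2 r, R j r & conv Delta id (emb (chi m)) r - sigma j r != 0.
  apply: NNPP => nbad; apply: nex; exists (chi m) => // r Rr; apply/esym/eqP.
  by rewrite -subr_eq0; apply: contraT => ne; case: nbad; exists r.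
have Ru : R j (sigma j b - b) by apply: (subB (hRj j)) => //; apply: (autS (hs j)).
(* [c] is the product of [sigma j b - b] with one witness of failure for each [m < q]; it is nonzero
   because [R j] is a domain. *)
have [c [Rc c0 hc]] : exists c, [/\ R j c, c != 0 & forall g, character (R j) g -> g c != 0 ->
    g (sigma j b - b) != 0 /\ forall m, (m < q)%N ->
      exists2 r, R j r & g (conv Delta id (emb (chi m)) r) <> g (sigma j r)].
  elim: (q) => [|d [c [Rc c0 hc]]].
    by exists (sigma j b - b); split; rewrite ?subr_eq0.
  have [r Rr hr] := bad d.
  have Rw : R j (conv Delta id (emb (chi d)) r - sigma j r).
    by apply: (subB (hRj j)); [apply: left_winding_sub | apply: (autS (hs j))].
  exists (c * (conv Delta id (emb (chi d)) r - sigma j r)); split.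
  - exact: (subM (hRj j)).
  - exact: dom.2.
  - move=> g cg; have [hg _ gM] := cg; rewrite gM // mulf_eq0 negb_or => /andP[gc gw].
    have [h1 h2] := hc g cg gc; split=> // m; rewrite ltnS leq_eqVlt => /orP[/eqP ->|/h2 //].
    by exists r => // e; move: gw; rewrite (lformB hg) e subrr eqxx.
have [g [cg gc _]] := separation (ltnW (ltn_ord j)) cm Rc Rc c0 c0.
have [gu hg] := hc g cg gc.
have [m mq hm] := winding_commutes Rb hchi echi cg gu.
by have [r Rr []] := hg m mq; apply: hm.
Qed.

(** Induction on [i], according to the degree in [x l] of the displacement [Q] of [x l] under
    [sigma j]: a constant is excluded by finite order, a nonconstant one yields a fixed
    character. *)
Lemma winding_finite_order chi : linear_form chi ->
  (forall r, R j r -> sigma j r = conv Delta id (emb chi) r) ->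
  forall i, (i <= j)%N -> forall r, R i r -> sigma j r = r.
Proof.
move=> hchi schi; elim=> [|i IH] ij r.
  by move=> /gen0[c ->]; rewrite (autZ (hs j)) ?(aut1 (hs j)) //; apply: (sub1 (hRj j)).
pose l := Ordinal (ltn_trans ij (ltn_ord j)).
have id_i := IH (ltnW ij).
have jn := ltnW (ltn_ord j).
have mono : forall r, R i.+1 r -> R j r by move=> c; apply: gen_mono; rewrite ij.
have mono0 : forall r, R i r -> R j r by move=> c; apply: gen_mono; rewrite (ltnW ij).
have hopfi : is_hopf_subalg Delta S (R i.+1) by apply/hhopf/(leq_trans ij).
have hRi : is_subalg (R i) by apply/hR/ltnW/(leq_trans ij).
have hRi1 : is_subalg (R i.+1) := hopf_subalg hopfi.
have cmi1 : commutative_on (R i.+1) by apply: commutative_mono cm; rewrite ij.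
have cmi : commutative_on (R i) by apply: commutative_mono cm; rewrite (ltnW ij).
have Rx : R i.+1 (x l) by apply: gen_var.
have sigS a : R i.+1 a -> R i.+1 (sigma j a).
  move=> Ra; rewrite schi; last exact: mono.
  apply: (conv_sub hopfi) => //; first exact: lin_emb.
  by move=> *; apply: (sub_emb hopfi).
have [P hP eP] : ore_span (R l) (x l) (sigma j (x l)) by apply/genS/sigS.
pose Q := P - 'X.
have hQ : poly_in (R l) Q by apply: (poly_inB hRi) => //; apply: (poly_inX hRi).
have eQ : Q.[x l] = sigma j (x l) - x l by rewrite hornerD hornerN hornerX eP.
(* A constant displacement lies in [R i], which [sigma j] fixes, so iterating [q] times adds [q]
   copies of it; their sum is zero, and characteristic 0 kills it. *)
case: (leqP (size Q) 1) => sQ.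
  have sx : sigma j (x l) = x l + Q`_0.
    by rewrite -[LHS](subrK (x l)) -eQ {1}(size1_polyC sQ) hornerC addrC.
  have Rc := hQ 0%N.
  have itx m : iter m (sigma j) (x l) = x l + Q`_0 *+ m.
    elim: m => [|m IHm]; first by rewrite mulr0n addr0.
    rewrite iterS IHm -scaler_nat (autD (hs j)) ?(autZ (hs j)) ?sx ?id_i //; try exact: mono.
    - by rewrite scaler_nat -addrA -mulrS.
    - exact: mono0.
    - exact/(subZ (hRj j))/mono0.
  have := hq (mono _ Rx); rewrite itx => /(canRL (addKr _)).
  rewrite addNr -scaler_nat => /eqP; rewrite scaler_eq0 (proj1 (pcharf0P _) char0).
  rewrite eqn0Ngt q0 /= => /eqP c0; move: sx; rewrite c0 addr0 => sx.
  have : is_subalg (fun a => R j a /\ sigma j a = a).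
    split.
    - by split; [apply: (sub1 (hRj j)) | apply: (aut1 (hs j))].
    - by move=> a b [Ra ha] [Rb hb]; rewrite (autD (hs j)) // ha hb; split=> //; apply: (subD (hRj j)).
    - by move=> c a [Ra ha]; rewrite (autZ (hs j)) // ha; split=> //; apply: (subZ (hRj j)).
    - by move=> a b [Ra ha] [Rb hb]; rewrite (autM (hs j)) // ha hb; split=> //; apply: (subM (hRj j)).
  move=> hB Rr; suff [] : R j r /\ sigma j r = r by [].
  move: r Rr; apply: gen_min => // m; rewrite ltnS leq_eqVlt => /orP[/eqP mi|mi].
    by have -> : m = l by [apply: val_inj]; split=> //; apply: mono.
  by split; [apply/mono0/gen_var | apply/id_i/gen_var].
have Q0 : lead_coef Q != 0 by rewrite lead_coef_eq0 -size_poly_gt0 ltnW.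
have in_ : (i <= n)%N by apply: ltnW; apply: (ltn_ord l).
(* A character nonzero on the leading coefficient keeps the image of [Q] nonconstant, so that it has
   a root in [k]. *)
have [g [cg gQ _]] := separation in_ cmi (hQ _) (hQ _) Q0 Q0.
have [hg _ _] := cg; have g0 := lform0 hg.
have /closed_rootP[t] : size (map_poly g Q) != 1%N.
  have sE : size Q = (size Q).-1.+1 by rewrite prednK // ltnW.
  rewrite neq_ltn; apply/orP; right; apply: leq_trans sQ _.
  rewrite {1}sE ltnNge; apply: contra gQ => /leq_sizeP/(_ _ (leqnn _)).
  by rewrite coef_map_id0 // => ->.
rewrite rootE => /eqP Qt.
(* Sending [x l] to the root [t] is allowed since [R i.+1] is commutative; it makes [p] vanish on
   [sigma j (x l) - x l]. *)
have [|p [cp ep eval_p]] := character_step (j := l) (t := t) cg.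
  by move=> c Rc; have [-> ->] := commutative_trivial (j := l) cmi1 Rc; rewrite g0 addr0.
have [hp p1 pM] := cp.
have px : p (sigma j (x l)) = p (x l).
  by apply/eqP; rewrite -subr_eq0 -(lformB hp) -eQ eval_p // Qt.
have fix_p a : R i.+1 a -> p (sigma j a) = p a.
  have hB : is_subalg (fun a => R i.+1 a /\ p (sigma j a) = p a).
    split.
    - by split; [apply: (sub1 hRi1) | rewrite (aut1 (hs j))].
    - move=> c d [Rc hc] [Rd hd']; split; first exact: (subD hRi1).
      by rewrite (autD (hs j)) ?(lformD hp) ?hc ?hd' //; apply: mono.
    - move=> c d [Rd hd']; split; first exact: (subZ hRi1).
      by rewrite (autZ (hs j)) ?(lformZ hp) ?hd' //; apply: mono.
    - move=> c d [Rc hc] [Rd hd']; split; first exact: (subM hRi1).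
      by rewrite (autM (hs j)) ?pM ?hc ?hd' //; try exact: sigS; apply: mono.
  move=> Ra; suff [] : R i.+1 a /\ p (sigma j a) = p a by [].
  move: a Ra; apply: gen_min => // m; rewrite ltnS leq_eqVlt => /orP[/eqP mi|mi].
    by have -> : m = l by [apply: val_inj]; split.
  by split; [apply/gen_var/leqW | rewrite id_i //; apply: gen_var].
move=> Rr; rewrite schi; last exact: mono.
(* Since [p] is fixed, the translation [chi] agrees with [eps] on [R i.+1], so its winding is the
   identity there. *)
have ce : forall a, R i.+1 a -> chi a = eps a.
  apply: (fixed_character hH hopfi cp hchi) => a Ra.
  by rewrite -schi ?fix_p //; apply: mono.
have he := eps_form hH.
rewrite -[RHS](conv_epsr hH _ (@lin_id k H)); apply: (conv_local hopfi) => //.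
- exact: lin_emb.
- exact: lin_emb.
- by move=> a Ra; rewrite /emb ce.
Qed.

End Step.

(** * Commutativity by induction along the chain *)

Lemma sigma_trivial (j : 'I_n) : PI_algebra H -> commutative_on (R j) ->
  forall r, R j r -> sigma j r = r.
Proof.
move=> PI cm r Rr; apply/eqP; apply: contraT => sr.
have dom := chain_domain (ltnW (ltn_ord j)) cm.
have [q q0 hq] := PI_automorphism (hRj j) dom (hs j) (hd j) (@hx j) (@chain_free j) PI Rr sr.
have [chi hchi schi] := sigma_winding cm q0 hq Rr sr.
by move: sr; rewrite (winding_finite_order cm q0 hq hchi schi (leqnn j) Rr) eqxx.
Qed.

Lemma commutative_chain i : PI_algebra H -> (i <= n)%N -> commutative_on (R i).
Proof.
move=> PI; elim: i => [|i IH] lt.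
  by move=> _ _ /gen0[a ->] /gen0[b ->]; rewrite -!scalerAl !mul1r !scalerA mulrC.
have cm := IH (ltnW lt); pose j := Ordinal lt.
have dom := chain_domain (ltnW lt) cm.
have s1 := sigma_trivial (j := j) PI cm.
have d0 := PI_derivation (hRj j) dom (hs j) (hd j) (@hx j) (@chain_free j) s1 char0 PI.
have xc r : R i r -> x j * r = r * x j.
  by move=> Rr; rewrite (skewE (@hx j) Rr) d0 // s1 // addr0.
(* Centralizers are subalgebras, so commutativity reduces, one factor at a time, to pairs of
   generators. *)
have centralizer (B : H -> Prop) : is_subalg (fun a => forall b, B b -> a * b = b * a).
  split.
  - by move=> b _; rewrite mul1r mulr1.
  - by move=> a a' ha ha' b Bb; rewrite mulrDl mulrDr ha // ha'.
  - by move=> c a ha b Bb; rewrite -scalerAl -scalerAr ha.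
  - by move=> a a' ha ha' b Bb; rewrite -mulrA ha' // !mulrA ha.
have gens (l : 'I_n) : (l < i.+1)%N -> forall b, R i.+1 b -> x l * b = b * x l.
  move=> li b Rb; apply/esym; pose B := fun a => a = x l.
  suff : forall c, B c -> b * c = c * b by apply.
  move: b Rb; apply: (gen_min (centralizer B)) => m mi _ ->.
  move: li mi; rewrite !ltnS [(l <= i)%N]leq_eqVlt [(m <= i)%N]leq_eqVlt => /orP[/eqP li|li] /orP[/eqP mi|mi].
  - by congr (x _ * x _); apply: val_inj; rewrite /= li mi.
  - by have -> : l = j by [apply: val_inj]; rewrite xc //; apply: gen_var.
  - by have -> : m = j by [apply: val_inj]; rewrite xc //; apply: gen_var.
  - by apply: cm; apply: gen_var.
by move=> a b Ra; move: a Ra b; apply: (gen_min (centralizer _)).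
Qed.

End Chain.

Theorem theorem5p4 (k : closedFieldType) (hk : [pchar k] =i pred0)
  (H : algType k) (Delta : H -> seq ('I_2 -> H)) (eps : H -> k) (S : H -> H) :
  is_IHOE Delta eps S -> PI_algebra H -> forall a b : H, a * b = b * a.
Proof.
case=> hH [_ [n [x [sigma [delta [hgen hhopf hore]]]]]] PI a b.
exact: (commutative_chain hk hH hgen hhopf hore PI (leqnn n)).
Qed.
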